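(* Let $\mathrm{dom}(U)=\mathbb R$ and let $U$ be continuously differentiable. For $t\ge0$ define $$S_t^0:=\Big\{i\in S\ \Big|\ \sum_{j\ne i}\frac{q_{ij}}{q_i}U\big(g(j)-c\vartheta\big)\le U\big(g(i)-c\vartheta\big)+\frac{c}{q_i}U'\big(g(i)-c\vartheta\big)\ \text{ for all }\vartheta\ge t\Big\}.$$ Suppose that for all $t\ge0$, $i\in S_t^0$ and $j\ne i$ the implication $q_{ij}\ne0\Longrightarrow j\in S_t^0$ is valid. Then for all $t\ge0$ and $i\in S_t^0$, the maximizer in $$V(t',i)=\sup_{\vartheta\ge0}\bigg\{U\big(g(i)-c(t'+\vartheta)\big)e^{-q_i\vartheta}+\int_0^\vartheta e^{-q_is}\sum_{j\ne i}q_{ij}V(t'+s,j)\,ds\bigg\}$$ is given by $h^*(t',i)=0$ for every $t'\ge t$ (i.e. the supremum is attained at $\vartheta=0$), and $V(t,i)=U\big(g(i)-ct\big)$.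
   Context: Markov chain: on a probability space $(\Omega,\mathcal F,\mathbb P)$, $(X_t)_{t\ge0}$ is a right-continuous continuous-time Markov chain with countable state space $S$ and intensity matrix $Q=(q_{ij})$, $0<q_i:=-q_{ii}=\sum_{j\ne i}q_{ij}<\infty$. Its jump times are $0=S_0<S_1<S_2<\dots$, $Z_n:=X_{S_n}$, and $X_t=\sum_{k\ge0}Z_k1_{\{S_k\le t<S_{k+1}\}}$ for all $t\ge0$; $S_{k+1}-S_k\sim\exp(q_{Z_k})$ and $\mathbb P(Z_{k+1}=j\mid Z_k=i)=q_{ij}/q_i$ for $j\ne i$. $(\mathcal F^X_t)$ is the natural filtration of $X$; $\mathbb P_i,\mathbb E_i$ denote probability and expectation given $X_0=i$. Utility, reward, cost: $U:\mathbb R\to\mathbb R$ is strictly increasing and strictly concave, $g:S\to\mathbb R$ is a reward function and $c>0$ a cost rate. $\Sigma$ is the set of $(\mathcal F^X_t)$-stopping times $\tau:\Omega\to[0,\infty)$ with $\mathbb P_i(\tau<\infty)=1$ for all $i\in S$. Standing assumptions: (A1) $\sup_{\tau\in\Sigma}\mathbb E_i[g^+(X_\tau)-c\tau]<\infty$ for all $i\in S$; (A2) $\liminf_{n\to\infty}\mathbb E_i[U(g(X_{\tau\wedge S_n})-c(t+\tau\wedge S_n))]\ge\mathbb E_i[U(g(X_\tau)-c(t+\tau))]$ for all $i\in S$, $t\ge0$, $\tau\in\Sigma$. Markovian stopping times: a Markovian stopping time is identified with a sequence $\tau=(h_0,h_1,\dots)$ of measurable maps $h_k:[0,\infty)\times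 S\to[0,\infty]$; given elapsed time $t\ge0$ it denotes the random time $\tau=S_k+h_k(t+S_k,Z_k)$ for the smallest $k\ge0$ with $S_k+h_k(t+S_k,Z_k)<S_{k+1}$ (and $\tau=\infty$ if there is none). $\Sigma^M$ is the class of such sequences for which $\tau$ is $\mathbb P_i$-a.s. finite for all $i\in S$, $t\ge0$. Value function: $V(t,i):=\sup_{\tau\in\Sigma^M}\mathbb E_i\big[U\big(g(X_\tau)-c(t+\tau)\big)\big]$, with $\tau$ formed with elapsed time $t$; it satisfies the displayed fixed point equation. *)

(* Defs.v *)
From HB Require Import structures.
From mathcomp Require Import all_boot all_order all_algebra.
From mathcomp Require Import all_classical all_reals all_analysis.
From mathcomp Require Import measurable_realfun.

Set Implicit Arguments.
Unset Strict Implicit.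
Unset Printing Implicit Defensive.
Import Order.TTheory GRing.Theory Num.Theory numFieldNormedType.Exports.

Local Open Scope classical_set_scope.
Local Open Scope ring_scope.

(* A countable state space is a measurableType S that is countable and has    *)
(* the discrete sigma-algebra.                                                *)
Definition countable_discrete (dS : measure_display) (S : measurableType dS) :=
  countable [set: S] /\ forall A : set S, measurable A.

Section Chain.
Context (R : realType) (dO dS : measure_display).
Context (Omega : measurableType dO) (S : measurableType dS).

(* sum over the states j <> i of extended real terms, as an integral against  *)
(* the counting measure (sum of the positive parts minus sum of the negative  *)
(* parts)                                                                     *)
Definition sum_neq (i : S) (f : S -> \bar R) : \bar R :=
  \int[@counting S R]_(j in ~` [set i]) f j.

Implicit Types (q : S -> S -> R) (X : R -> Omega -> S) (Sn : nat -> Omega -> R).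
Implicit Types (P : S -> probability Omega R).

Definition rate q (i : S) : R := - q i i.

Definition intensity_matrix q : Prop :=
  [/\ forall i j, j != i -> 0 <= q i j,
      forall i, 0 < rate q i
    & forall i, sum_neq i (fun j => (q i j)%:E) = (rate q i)%:E].

(* the sequence (Sn k) is the sequence of jump times of (X t), t >= 0, and    *)
(* these do not accumulate                                                    *)
Definition jump_times X Sn : Prop :=
  forall w : Omega,
  [/\ Sn 0%N w = 0,
      forall k, Sn k w < Sn k.+1 w,
      forall k t, Sn k w <= t < Sn k.+1 w -> X t w = X (Sn k w) w,
      forall k, X (Sn k.+1 w) w != X (Sn k w) w
    & forall t, exists k, t < Sn k w].

Definition embedded X Sn (k : nat) (w : Omega) : S := X (Sn k w) w.

(* sigma-algebra generated by Z_0, S_0, ..., Z_k, S_k                         *)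
Definition history X Sn (k : nat) : set (set Omega) :=
  <<s [set A | exists2 m : nat, (m <= k)%N &
    (exists B : set S, A = embedded X Sn m @^-1` B) \/
    (exists2 B : set R, measurable B & A = Sn m @^-1` B)] >>.

(* The family (P i) makes X a right-continuous non-explosive Markov chain     *)
(* with intensity matrix q, in the jump chain/holding time sense: under P i   *)
(* the chain starts in i and, given the history up to the k-th jump, on       *)
(* Z_k = a, the holding time S_(k+1) - S_k is exponential with rate q_a and   *)
(* is independent of Z_(k+1), which equals b <> a with probability            *)
(* q_ab / q_a.                                                                *)
Definition markov_chain q X Sn P : Prop :=
  [/\ intensity_matrix q,
      forall t, 0 <= t -> measurable_fun setT (X t),
      forall k, measurable_fun setT (Sn k),
      jump_times X Sn
    & forall i, P i [set w | X 0 w = i] = 1%E /\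
      forall (k : nat) (A : set Omega) (a b : S) (B : set R),
        history X Sn k A -> a != b -> measurable B ->
        P i (A `&` [set w | embedded X Sn k w = a]
               `&` [set w | embedded X Sn k.+1 w = b]
               `&` [set w | B (Sn k.+1 w - Sn k w)]) =
        (P i (A `&` [set w | embedded X Sn k w = a]) *
         ((q a b / rate q a)%:E * exponential_prob (rate q a) B))%E].

Definition natural_filtration X (t : R) : set (set Omega) :=
  <<s [set A | exists2 s : R, 0 <= s <= t &
         exists B : set S, A = X s @^-1` B] >>.

(* Stopping times may be infinite on a set that is P i-null for all i; below, *)
(* X_tau and tau are evaluated through fine (tau w), which is 0 on that set.  *)
(* An expectation of the form oo - oo is -oo in the library.                  *)
Definition stopping_times X P : set (Omega -> \bar R) :=
  [set tau | [/\ forall w, (0 <= tau w)%E,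
    forall t, 0 <= t -> natural_filtration X t [set w | (tau w <= t%:E)%E]
    & forall i, P i [set w | (tau w < +oo)%E] = 1%E]].

Definition payoff X (U : R -> R) (g : S -> R) (c : R) (t : R)
    (tau : Omega -> \bar R) (w : Omega) : R :=
  U (g (X (fine (tau w)) w) - c * (t + fine (tau w))).

Definition positive_gain X (g : S -> R) (c : R) (tau : Omega -> \bar R)
    (w : Omega) : R :=
  Num.max (g (X (fine (tau w)) w)) 0 - c * fine (tau w).

Definition assumption_A1 X P (g : S -> R) (c : R) : Prop :=
  forall i : S,
  (ereal_sup [set 'E_(P i)[positive_gain X g c tau]
             | tau in stopping_times X P] < +oo)%E.

Definition assumption_A2 X Sn P (U : R -> R) (g : S -> R) (c : R) : Prop :=
  forall (i : S) (t : R) (tau : Omega -> \bar R),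
  0 <= t -> stopping_times X P tau ->
  ('E_(P i)[payoff X U g c t tau] <=
   limn_einf (fun n : nat => 'E_(P i)[payoff X U g c t
     (fun w => Order.min (tau w) (Sn n w)%:E)]))%E.

Implicit Types h : nat -> R * S -> \bar R.

Definition candidate X Sn h (t : R) (k : nat) (w : Omega) : \bar R :=
  ((Sn k w)%:E + h k (t + Sn k w, embedded X Sn k w)%R)%E.

Definition stops_before X Sn h (t : R) (w : Omega) (k : nat) : bool :=
  (candidate X Sn h t k w < (Sn k.+1 w)%:E)%E.

(* the random time denoted by h = (h_0, h_1, ...) for the elapsed time t      *)
Definition markovian_time X Sn h (t : R) (w : Omega) : \bar R :=
  if pselect (exists k, stops_before X Sn h t w k) is left stops
  then candidate X Sn h t (ex_minn stops) w else +oo%E.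

Definition markovian_stopping_times X Sn P : set (nat -> R * S -> \bar R) :=
  [set h : nat -> R * S -> \bar R |
   [/\ forall k, measurable_fun [set x : R * S | 0 <= x.1] (h k),
    forall k x, 0 <= x.1 -> (0 <= h k x)%E
    & forall i t, 0 <= t ->
        P i [set w | (markovian_time X Sn h t w < +oo)%E] = 1%E]].

Definition value X Sn P (U : R -> R) (g : S -> R) (c : R) (t : R) (i : S) :
    \bar R :=
  ereal_sup [set 'E_(P i)[payoff X U g c t (markovian_time X Sn h t)]%E
            | h in markovian_stopping_times X Sn P].

(* the expression maximized over theta in the fixed point equation, for a     *)
(* function V of time and state                                               *)
Definition bellman_objective q (U : R -> R) (g : S -> R) (c : R)
    (V : R -> S -> \bar R) (t : R) (i : S) (theta : R) : \bar R :=
  ((U (g i - c * (t + theta)) * expR (- rate q i * theta))%:E +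
   \int[lebesgue_measure]_(s in `[0%R, theta])
     ((expR (- rate q i * s))%:E *
      sum_neq i (fun j => (q i j)%:E * V (t + s)%R j)))%E.

Definition stopping_set q (U : R -> R) (g : S -> R) (c : R) (t : R) : set S :=
  [set i | forall theta, t <= theta ->
    (sum_neq i (fun j => (q i j / rate q i * U (g j - c * theta))%:E) <=
     (U (g i - c * theta) + c / rate q i * derive1 U (g i - c * theta))%:E)%E].

End Chain.

Definition strictly_concave (R : realType) (U : R -> R) : Prop :=
  forall x y a : R, x != y -> 0 < a < 1 ->
    a * U x + (1 - a) * U y < U (a * x + (1 - a) * y).

Definition continuously_differentiable (R : realType) (U : R -> R) : Prop :=
  (forall x, derivable U x 1) /\ continuous (derive1 U).

(* Main.v *)
Require Import Defs.
From HB Require Import structures.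
From mathcomp Require Import all_boot all_order all_algebra.
From mathcomp Require Import all_classical all_reals all_analysis.
From mathcomp Require Import measurable_realfun.
From mathcomp Require Import ring lra.

(** In a state a of the stopping set at elapsed time u put
    phi s = U (g a - c * (u + s)), and let r be the rate of a. Stopping at once
    earns phi 0. Planning to stop after a further time theta earns phi theta
    with probability expR (- r * theta), and otherwise the reward in the next
    state. The condition that defines the stopping set bounds the mean of the
    latter, for a jump at time s, by phi s - phi' s / r. The density of the jump
    time times this bound is minus the derivative of expR (- r * s) * phi s.
    Hence the expected reward of the plan telescopes to at most phi 0
    ([jump_mean_reward_le]). For theta = +oo a boundary term remains; it
    vanishes along a sequence of times whenever the loss after the jump is
    integrable ([discounted_loss_small]).

    The closure hypothesis keeps the chain in the stopping set
    ([reachable_states]), so for every Markovian rule the reward stopped at the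
    jump times is a supermartingale. Since rewards need not be integrable, this
    is stated for the means of the positive and negative parts: the reward has
    nonpositive drift ([stopped_reward_drift]) and the mean of its negative part
    grows ([stopped_loss_mono]), which together are enough to compare
    expectations ([drift_le]). The step from one jump to the process is a
    disintegration along the next jump ([integral_jump]). A Markovian time is
    a stopping time of the natural filtration ([markovian_time_adapted]), so the
    second standing assumption carries the bound from the stopped rewards to the
    rule itself ([value_le]). The rule that stops at once attains it.

    The states that contribute to the fixed point equation are again in the
    stopping set. Their values being known, the integral in the objective is
    bounded by the same telescoping integral ([integral_excess_bound]), and the
    objective is largest at theta = 0. *)

Import Order.TTheory GRing.Theory Num.Theory numFieldNormedType.Exports.
Local Open Scope classical_set_scope.
Local Open Scope ring_scope.

(** * Sums over a countable state space *)

(** Both parts of the integral are suprema over the simple functions below the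
    integrand, so they are monotone for arbitrary functions. In this generality
    the bound applies to integrands that contain the value function. *)
Lemma le_integral_pointwise {d} {T : measurableType d} {R : realType}
    (mu : {measure set T -> \bar R}) (D : set T) (f g : T -> \bar R) :
  (forall x, D x -> (f x <= g x)%E) ->
  (\int[mu]_(x in D) f x <= \int[mu]_(x in D) g x)%E.
Proof.
move=> fg; rewrite /integral.
have fgD x : ((f \_ D) x <= (g \_ D) x)%E.
  by rewrite !patchE; case: ifPn => // /[!inE]; exact: fg.
apply: leeB; apply: ereal_sup_le => _ [h /= hf <-]; exists h => //= x;
  apply: le_trans (hf x) _.
  by rewrite !funeposE ge_max !le_max fgD lexx orbT.
by rewrite !funenegE ge_max !le_max leeN2 fgD lexx orbT.
Qed.

Section CountableSums.
Local Open Scope ereal_scope.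
Context {R : realType} {dS : measure_display} {S : measurableType dS}.
Hypothesis hS : countable_discrete S.
Local Notation counting := (@counting S R).

Lemma integral_counting_set1 (a : S) (f : S -> \bar R) :
  \int[counting]_(b in [set a]) f b = f a.
Proof.
have mA (A : set S) : measurable A by exact: hS.2.
rewrite (eq_integral (cst (f a))); last by move=> b /[!inE] ->.
rewrite integral_cst//= /counting/= asboolT; last exact: finite_set1.
by rewrite fset_set1 finmap.cardfs1 mule1.
Qed.

Lemma counting_measurable (D : set S) (f : S -> \bar R) : measurable_fun D f.
Proof. by move=> _ Y _; exact: hS.2. Qed.

(** The fibres of an injection of S into nat. Allowing empty cells covers the
    finite and the empty state space together with the infinite one. *)
Lemma countable_cells : exists C : nat -> set S,
  [/\ trivIset setT C, \bigcup_n C n = setT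
    & forall n, C n = set0 \/ exists a, C n = [set a]].
Proof.
have /countable_injP[e einj] := hS.1.
exists (fun n => e @^-1` [set n]); split.
- by apply/trivIsetP => m n _ _ mn; apply/seteqP; split => // a [/= -> /eqP];
    rewrite (negbTE mn).
- by apply/seteqP; split => // a _; exists (e a).
- move=> n; have [[a ea]|noa] := pselect (exists a, e a = n).
    right; exists a; apply/seteqP; split=> b /=; last by move=> ->.
    by move=> eb; apply: einj; rewrite ?inE// ea eb.
  by left; apply/seteqP; split => // a ea; apply: noa; exists a.
Qed.

Lemma counting_series (D : set S) : exists C : nat -> set S,
  (forall n, C n = set0 \/ exists2 a, D a & C n = [set a]) /\
  forall f : S -> \bar R, (forall b, 0 <= f b) ->
  \int[counting]_(b in D) f b = \sum_(n <oo) \int[counting]_(b in C n) f b.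
Proof.
have [C [tC UC C1]] := countable_cells.
exists (fun n => D `&` C n); split.
  move=> n; have [->|[a ->]] := C1 n; first by left; rewrite setI0.
  have [Da|Da] := pselect (D a).
    right; exists a => //; apply/seteqP; split => b /=; first by case.
    by move=> ->.
  by left; apply/seteqP; split => // b /= [Db ba]; apply: Da; rewrite -ba.
move=> f f0; rewrite -ge0_integral_bigcup//.
- by rewrite -setI_bigcupr UC setIT.
- by move=> n; exact: hS.2.
- exact: counting_measurable.
- exact: trivIset_setIl.
Qed.

(** Tonelli for the counting measure: by [counting_series] the inner integral is
    a series of functions, and integrals commute with nonnegative series. *)
Lemma integral_counting_exchange {d} {T : measurableType d}
    (mu : {measure set T -> \bar R}) {D : set T} {E : set S}
    {f : T -> S -> \bar R} : measurable D ->
  (forall b, E b -> measurable_fun D (f^~ b)) -> (forall x b, 0 <= f x b) ->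
  measurable_fun D (fun x => \int[counting]_(b in E) f x b) /\
  \int[mu]_(x in D) \int[counting]_(b in E) f x b =
  \int[counting]_(b in E) \int[mu]_(x in D) f x b.
Proof.
move=> mD mf f0; have [C [C1 CE]] := counting_series E.
have F0 n x : 0 <= \int[counting]_(b in C n) f x b by exact: integral_ge0.
have mF n : measurable_fun D (fun x => \int[counting]_(b in C n) f x b).
  have [->|[a Ea ->]] := C1 n.
    by under eq_fun do rewrite integral_set0; exact: measurable_cst.
  by under eq_fun do rewrite integral_counting_set1; exact: mf.
have fE : (fun x => \int[counting]_(b in E) f x b) =
    (fun x => \sum_(n <oo) \int[counting]_(b in C n) f x b).
  by apply/funext => x; exact: CE.
split; first by rewrite fE; apply: ge0_emeasurable_sum => //.
rewrite fE integral_nneseries// CE; last by move=> b; exact: integral_ge0.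
apply: eq_eseriesr => n _; have [->|[a Ea ->]] := C1 n.
  under eq_integral do rewrite integral_set0.
  by rewrite integral0 integral_set0.
rewrite integral_counting_set1.
by under eq_integral do rewrite integral_counting_set1.
Qed.

Lemma measurable_fun_discrete {d d'} {T : measurableType d}
    {T' : measurableType d'} {f : T -> S -> T'} {Z : T -> S} :
  (forall b, measurable_fun setT (f^~ b)) -> measurable_fun setT Z ->
  measurable_fun setT (fun x => f x (Z x)).
Proof.
move=> mf mZ _ B mB; rewrite setTI.
rewrite (_ : _ @^-1` B = \bigcup_(b : S) (Z @^-1` [set b] `&` f^~ b @^-1` B)).
  apply: countable_bigcupT_measurable; first exact: hS.1.
  move=> b; apply: measurableI.
    by rewrite -[_ @^-1` _]setTI; apply: mZ => //; exact: hS.2.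
  by rewrite -[_ @^-1` _]setTI; exact: mf.
apply/seteqP; split => x /=; first by move=> Bx; exists (Z x).
by move=> [b _ [/= ->]].
Qed.

(** Conditioning on a discrete variable Z: f x is the sum over b of f x times
    the indicator of Z x = b, and the sum can be taken out of the integral. *)
Lemma integral_fibers {d} {T : measurableType d}
    (mu : {measure set T -> \bar R}) {D : set T} {Z : T -> S}
    {f : T -> \bar R} : measurable D -> measurable_fun setT Z ->
  measurable_fun D f -> (forall x, 0 <= f x) ->
  \int[mu]_(x in D) f x =
  \int[counting]_b \int[mu]_(x in D `&` Z @^-1` [set b]) f x.
Proof.
move=> mD mZ mf f0.
have mZb b : measurable (Z @^-1` [set b]).
  by rewrite -[_ @^-1` _]setTI; apply: mZ => //; exact: hS.2.
transitivity (\int[mu]_(x in D) \int[counting]_b (f \_ (Z @^-1` [set b])) x).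
  apply: eq_integral => x _.
  transitivity (\int[counting]_(b in [set Z x]) f x).
    by rewrite integral_counting_set1.
  rewrite integral_mkcond; apply: eq_integral => b _.
  by rewrite !patchE; congr (if _ then _ else _); apply/idP/idP; rewrite !inE.
rewrite (integral_counting_exchange mu mD _ _).2//; last 2 first.
- move=> b _; apply/(measurable_restrict _ _ mD) => //.
  by apply: measurable_funS mf => // x [].
- by move=> x b; apply: erestrict_ge0.
by apply: eq_integral => b _; rewrite -integral_mkcondr.
Qed.

End CountableSums.

(** * Discounted utility while waiting *)
Section Discounting.
Context {R : realType}.
Implicit Types (U : R -> R) (r c x y : R).
Local Notation lambda := (@lebesgue_measure R).

Lemma is_derive_discounted U r c x s : derivable U (x - c * s) 1 ->
  is_derive s 1 (fun s => - (expR (- r * s) * U (x - c * s)))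
    (expR (- r * s) * (r * U (x - c * s) + c * derive1 U (x - c * s))).
Proof.
move=> dU.
have dlin k : is_derive s 1 (fun s : R => k * s) k.
  rewrite -[X in is_derive _ _ _ X](mulr1 k).
  exact: (@is_deriveZ _ _ _ _ k _ _ _ (is_derive_id s 1)).
have dshift : is_derive s 1 (fun s : R => x - c * s) (- c).
  rewrite -[X in is_derive _ _ _ X]sub0r.
  exact: (@is_deriveB _ _ _ (cst x) _ _ _ _ _ (is_derive_cst _ _ _) (dlin c)).
have dU' : is_derive (x - c * s) 1 U (derive1 U (x - c * s)).
  by rewrite derive1E; exact: derivableP.
have dUc := @is_derive1_comp _ U (fun s => x - c * s) s _ _ dU' dshift.
have dexp := @is_derive1_comp _ expR (fun s => - r * s) s _ _
  (is_derive_expR (- r * s)) (dlin (- r)).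
have := is_deriveN (is_deriveM dexp dUc).
set D := (X in is_derive _ _ _ X -> _) => dF.
suff <- : D = expR (- r * s) *
    (r * U (x - c * s) + c * derive1 U (x - c * s)) by exact: dF.
by rewrite /D /GRing.scale/=; ring.
Qed.

Lemma continuous_discounted U r c x : continuously_differentiable U ->
  continuous (fun s => expR (- r * s) *
                       (r * U (x - c * s) + c * derive1 U (x - c * s))).
Proof.
move=> [dU cU'] s.
have cU y : {for y, continuous U}.
  by apply: differentiable_continuous; apply/derivable1_diffP; exact: dU.
have clin : {for s, continuous (fun s : R => x - c * s)}.
  apply: cvgB; first exact: cvg_cst.
  by apply: cvgM; [exact: cvg_cst|exact: cvg_id].
apply: cvgM.
  apply: (@continuous_comp _ _ _ (fun s : R => - r * s) expR).
    by apply: cvgM; [exact: cvg_cst|exact: cvg_id].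
  exact: continuous_expR.
apply: cvgD; apply: cvgM; [exact: cvg_cst| |exact: cvg_cst|].
  by apply: (@continuous_comp _ _ _ (fun s : R => x - c * s) U); last exact: cU.
apply: (@continuous_comp _ _ _ (fun s : R => x - c * s) (derive1 U)) => //.
exact: cU'.
Qed.

(** The integrand is minus the derivative of expR (- r * s) * U (x - c * s), the
    utility of stopping at time s weighted by the probability of no jump before.
    It is also r expR (- r * s) times the bound in the definition of
    [stopping_set], so that condition telescopes when it is integrated against
    the exponential law of the next jump. *)
Lemma integral_discounted U r c x y : continuously_differentiable U -> 0 <= y ->
  (\int[lambda]_(s in `[0%R, y])
     (expR (- r * s) * (r * U (x - c * s) + c * derive1 U (x - c * s)))%:E =
   (U x - expR (- r * y) * U (x - c * y))%:E)%E.
Proof.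
move=> U1; rewrite le_eqVlt => /predU1P[<-|y0].
  rewrite set_itv1 integral_set1.
  by rewrite !mulr0 expR0 mul1r subr0 subrr.
pose F (s : R) : R := - (expR (- r * s) * U (x - c * s)).
have dF (s : R) : is_derive s 1 F
    (expR (- r * s) * (r * U (x - c * s) + c * derive1 U (x - c * s))).
  by apply: is_derive_discounted; exact: U1.1.
have cF (s : R) : {for s, continuous F}.
  by apply: differentiable_continuous; apply/derivable1_diffP; exact: ex_derive.
rewrite (@continuous_FTC2 _ _ F)//.
- by rewrite -EFinB /F !mulr0 expR0 mul1r subr0 opprK addrC.
- by apply: continuous_subspaceT; exact: continuous_discounted.
- split.
  + by move=> s _; exact: ex_derive.
  + by apply: cvg_at_right_filter; exact: cF.
  + by apply: cvg_at_left_filter; exact: cF.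
- by move=> s _; rewrite derive1E; exact: derive_val.
Qed.

End Discounting.

(** * The exponential law *)
Section ExponentialLaw.
Context {R : realType} (r : R) (r0 : 0 < r).
Local Notation lambda := (@lebesgue_measure R).

(** [exponential_prob r] as a probability, a structure that depends on r0. *)
Definition exponential_law : probability (measurableTypeR R) R.
Proof. by refine (exponential_prob r : probability _ _). Defined.

Definition exponential_density (s : R) : R := r * expR (- r * s).

Lemma exponential_density_ge0 s : 0 <= exponential_density s.
Proof. by rewrite mulr_ge0// ?expR_ge0// ltW. Qed.

Lemma continuous_exponential_density : continuous exponential_density.
Proof.
move=> s; apply: cvgM; first exact: cvg_cst.
apply: (@continuous_comp _ _ _ (fun s : R => - r * s) expR).
  by apply: cvgM; [exact: cvg_cst|exact: cvg_id].
exact: continuous_expR.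
Qed.

Lemma measurable_exponential_density D : measurable_fun D exponential_density.
Proof.
apply: measurable_funTS; apply: continuous_measurable_fun.
exact: continuous_exponential_density.
Qed.

(** The density represents [exponential_law] on every measurable set, hence it
    is almost everywhere its Radon-Nikodym derivative, for which the change of
    variables holds. *)
Lemma integral_exponential_law (f : R -> \bar R) :
  measurable_fun setT f -> (forall s, 0 <= f s)%E ->
  (\int[exponential_prob r]_s f s =
   \int[lambda]_(s in `[0%R, +oo[) (f s * (exponential_density s)%:E))%E.
Proof.
move=> mf f0.
pose p s := (exponential_pdf r s)%:E.
have mp D : measurable_fun D p.
  by apply/measurable_funTS/measurable_EFinP; exact: measurable_exponential_pdf.
have dom : exponential_law `<< lambda.
  apply/null_content_dominatesP => A mA A0.
  have -> : exponential_law A = (\int[lambda]_(s in A) p s)%E by [].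
  exact: (@null_set_integral _ _ _ lambda A p mA (mp A) A0).
transitivity (\int[lambda]_s (f s * p s))%E.
  transitivity (\int[exponential_law]_s f s)%E; first by [].
  rewrite -(Radon_Nikodym_SigmaFinite.change_of_variables dom)//.
  have int := Radon_Nikodym_SigmaFinite.f_integrable dom.
  apply: ae_eq_integral => //.
  - by apply: emeasurable_funM => //; exact: measurable_int int.
  - exact: (emeasurable_funM mf (mp setT)).
  - apply: ae_eqe_mul2l; apply: integral_ae_eq => //; first exact: (mp setT).
    by move=> E _ mE; rewrite -Radon_Nikodym_SigmaFinite.f_integral.
rewrite [RHS]integral_mkcond; apply: eq_integral => s _; rewrite patchE.
rewrite /p /exponential_pdf patchE; case: ifPn => // _.
by rewrite mule0.
Qed.

Lemma integral_exponential_tail (x : R) :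
  (\int[lambda]_(s in `]x, +oo[) (exponential_density s)%:E =
   (expR (- r * x))%:E)%E.
Proof.
have dF (s : R) : is_derive s 1 (fun s : R => - expR (- r * s))
    (exponential_density s).
  have dlin : is_derive s 1 (fun s : R => - r * s) (- r).
    rewrite -[X in is_derive _ _ _ X](mulr1 (- r)).
    exact: (@is_deriveZ _ _ _ _ (- r) _ _ _ (is_derive_id s 1)).
  have := is_deriveN (@is_derive1_comp _ expR (fun s => - r * s) s _ _
    (is_derive_expR (- r * s)) dlin).
  set D := (X in is_derive _ _ _ X -> _) => dF.
  suff <- : D = exponential_density s by exact: dF.
  by rewrite /D /exponential_density; ring.
rewrite integral_itv_obnd_cbnd; last first.
  by apply/measurable_EFinP; exact: measurable_exponential_density.
rewrite (@ge0_continuous_FTC2y _ _ (fun s : R => - expR (- r * s)) _ 0)//.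
- by rewrite EFinN oppeK add0e.
- by move=> s _; exact: exponential_density_ge0.
- by apply: continuous_subspaceT; exact: continuous_exponential_density.
- rewrite -oppr0; apply: cvgN.
  rewrite (_ : (fun s => expR (- r * s)) =
               (fun z => expR (- z)) \o (fun z => r * z)); last first.
    by apply/funext => s /=; rewrite mulNr.
  apply: (@cvg_comp _ _ _ _ _ _ (pinfty_nbhs R)); last exact: cvgr_expR.
  exact: gt0_cvgMry.
- apply: cvg_at_right_filter.
  have [dFx _] := dF x; move/derivable1_diffP : dFx.
  exact: differentiable_continuous.
- by move=> s _; rewrite derive1E; exact: derive_val.
Qed.

End ExponentialLaw.

(** * Positive and negative parts *)

(** Rewards need not be integrable and an expectation oo - oo is -oo, so that
    differences of expectations cannot be added. Inequalities A - B <= C - D are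
    therefore carried around as A + D <= C + B in the interval [0, +oo]. *)
Section PositivePart.
Context {R : realType}.
Implicit Types x y : R.

Definition posr x := Num.max x 0.
Definition negr x := posr (- x).

Lemma posr_ge0 x : 0 <= posr x. Proof. by rewrite le_max lexx orbT. Qed.
Lemma negr_ge0 x : 0 <= negr x. Proof. exact: posr_ge0. Qed.

Lemma posrM k x : 0 <= k -> posr (k * x) = k * posr x.
Proof. by move=> k0; rewrite /posr maxr_pMr// mulr0. Qed.

Lemma negrM k x : 0 <= k -> negr (k * x) = k * negr x.
Proof. by move=> k0; rewrite /negr -mulrN posrM. Qed.

Lemma posr_negr x : x = posr x - negr x.
Proof. by rewrite /negr /posr; case: (leP x 0); case: (leP (- x) 0); lra. Qed.

Lemma posr_or_negr x :
  (posr x = x /\ negr x = 0) \/ (posr x = 0 /\ negr x = - x).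
Proof. by rewrite /negr /posr; case: (leP x 0); case: (leP (- x) 0); lra. Qed.

Lemma negr_le x y : x <= y -> negr y <= negr x.
Proof. by move=> xy; rewrite /negr /posr ge_max !le_max lerN2 xy lexx orbT. Qed.

Lemma measurable_posr : measurable_fun setT posr.
Proof. exact: measurable_maxr. Qed.

Lemma measurable_negr : measurable_fun setT negr.
Proof.
by apply: (measurableT_comp measurable_posr); exact: oppr_measurable.
Qed.

Lemma sube_le_posr_negr (A B : \bar R) x : (0 <= A)%E -> (0 <= B)%E ->
  (A - B <= x%:E)%E -> (A + (negr x)%:E <= (posr x)%:E + B)%E.
Proof.
case: A => [A| |]//; case: B => [B| |]//; rewrite ?addey ?leey//.
rewrite !lee_fin => _ _ ABx; have := posr_negr x; lra.
Qed.

Lemma integral_posr_negr {d} {T : measurableType d}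
    (mu : {measure set T -> \bar R}) (D : set T) (f : T -> R) :
  (\int[mu]_(x in D) (f x)%:E =
   \int[mu]_(x in D) (posr (f x))%:E - \int[mu]_(x in D) (negr (f x))%:E)%E.
Proof.
rewrite integralE; congr (_ - _)%E; apply: eq_integral => x _.
  by rewrite funeposE -EFin_max.
by rewrite funenegE -EFinN -EFin_max.
Qed.

End PositivePart.

(** * Expectation over one jump *)
Section JumpMean.
Local Open Scope ereal_scope.
Context {R : realType} {dS : measure_display} {S : measurableType dS}.
Context (hS : countable_discrete S) {q : S -> S -> R}.
Hypothesis hq : intensity_matrix q.
Local Notation lambda := (@lebesgue_measure R).

Definition jump_prob (a b : S) : R := (q a b / rate q a)%R.

(** The expectation of f (holding time) (next state) for the chain in state a:
    the holding time is exponential and independent of the next state. *)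
Definition jump_mean (a : S) (f : R -> S -> \bar R) : \bar R :=
  sum_neq a (fun b =>
    (jump_prob a b)%:E * \int[exponential_prob (rate q a)]_s f s b).

Lemma rate_gt0 a : (0 < rate q a)%R. Proof. by have [_ + _] := hq; exact. Qed.

Lemma jump_prob_ge0 {a b} : b != a -> (0 <= jump_prob a b)%R.
Proof.
by move=> ba; have [q0 _ _] := hq; rewrite divr_ge0 ?q0// ltW// rate_gt0.
Qed.

Lemma eq_sum_neq a (f f' : S -> \bar R) : (forall b, b != a -> f b = f' b) ->
  sum_neq a f = sum_neq a f'.
Proof.
by move=> ff'; apply: eq_integral => b /[!inE] /eqP ba; exact: ff'.
Qed.

Lemma sum_neq_ge0 a (f : S -> \bar R) : (forall b, b != a -> 0 <= f b) ->
  0 <= sum_neq a f.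
Proof. by move=> f0; apply: integral_ge0 => b /eqP; exact: f0. Qed.

Lemma sum_neqZl a k (f : S -> \bar R) : (0 <= k)%R ->
  (forall b, b != a -> 0 <= f b) ->
  sum_neq a (fun b => k%:E * f b) = k%:E * sum_neq a f.
Proof.
move=> k0 f0; apply: ge0_integralZl_EFin => //; first exact: hS.2.
  by move=> b /eqP; exact: f0.
exact: counting_measurable.
Qed.

Lemma sum_jump_prob a : sum_neq a (fun b => (jump_prob a b)%:E) = 1.
Proof.
have [q0 r0 qE] := hq.
rewrite (@eq_sum_neq _ _ (fun b => (rate q a)^-1%:E * (q a b)%:E)); last first.
  by move=> b _; rewrite -EFinM mulrC.
rewrite sum_neqZl ?qE ?invr_ge0 ?(ltW (r0 _))//.
  by rewrite -EFinM mulVf// gt_eqF.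
by move=> b ba; rewrite lee_fin q0.
Qed.

Lemma jump_prob_supported a : exists b, b != a /\ (0 < jump_prob a b)%R.
Proof.
apply: contrapT => none; have := sum_jump_prob a.
rewrite (@eq_sum_neq _ _ (cst 0)).
  by rewrite /sum_neq integral0 => /eqP; rewrite lt_eqF.
move=> b ba; apply/eqP; rewrite eqe eq_le jump_prob_ge0// andbT leNgt.
by apply/negP => pb; apply: none; exists b.
Qed.

Lemma measurable_jump_sum a (f : R -> S -> \bar R) D :
  (forall b, measurable_fun setT (f^~ b)) -> (forall s b, 0 <= f s b) ->
  measurable_fun D (fun s => sum_neq a (fun b => (jump_prob a b)%:E * f s b)).
Proof.
move=> mf f0; apply: measurable_funTS.
(* the weights are nonnegative only for b <> a, hence the positive parts *)
have mpf b : measurable_fun setT (fun s => (posr (jump_prob a b))%:E * f s b).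
  exact: measurable_funeM.
have pf0 s b : 0 <= (posr (jump_prob a b))%:E * f s b.
  by rewrite mule_ge0// lee_fin posr_ge0.
have [mF _] := integral_counting_exchange hS lambda (E := ~` [set a])
  measurableT (fun b _ => mpf b) pf0.
apply: eq_measurable_fun mF => s _; apply: eq_sum_neq => b ba.
by rewrite /posr max_l// jump_prob_ge0.
Qed.

Lemma jump_meanE a (f : R -> S -> \bar R) :
  (forall b, measurable_fun setT (f^~ b)) -> (forall s b, 0 <= f s b) ->
  jump_mean a f = \int[lambda]_(s in `[0%R, +oo[)
    (sum_neq a (fun b => (jump_prob a b)%:E * f s b) *
     (exponential_density (rate q a) s)%:E).
Proof.
move=> mf f0; have r0 := rate_gt0 a.
pose p b := posr (jump_prob a b).
have pE b : b != a -> p b = jump_prob a b.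
  by move=> ba; rewrite /p /posr max_l// jump_prob_ge0.
have p0 b : 0 <= (p b)%:E by rewrite lee_fin posr_ge0.
have [_ pfE] := integral_counting_exchange hS (exponential_law _ r0)
  (E := ~` [set a]) measurableT (fun b _ => measurable_funeM (p b)%:E (mf b))
  (fun s b => mule_ge0 (p0 b) (f0 s b)).
have mpf : measurable_fun setT
    (fun s => sum_neq a (fun b => (p b)%:E * f s b)).
  apply: eq_measurable_fun (measurable_jump_sum a f setT mf f0) => s _.
  by apply: eq_sum_neq => b ba; rewrite pE.
have sE s : sum_neq a (fun b => (jump_prob a b)%:E * f s b) =
    sum_neq a (fun b => (p b)%:E * f s b).
  by apply: eq_sum_neq => b ba; rewrite pE.
under eq_integral do rewrite sE.
rewrite -(@integral_exponential_law _ _ r0)//; last first.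
  by move=> s; apply: sum_neq_ge0 => b _; rewrite mule_ge0.
transitivity
  (\int[exponential_law _ r0]_s sum_neq a (fun b => (p b)%:E * f s b)).
  rewrite [RHS]pfE; apply: eq_sum_neq => b ba.
  by rewrite ge0_integralZl_EFin ?pE// ?jump_prob_ge0//; exact: mf.
by [].
Qed.

Lemma jump_mean_cst a (k : \bar R) : 0 <= k -> jump_mean a (fun _ _ => k) = k.
Proof.
move=> k0; have r0 := rate_gt0 a; rewrite /jump_mean.
have -> : \int[exponential_prob (rate q a)]_s k = k.
  transitivity (k * exponential_law _ r0 setT).
    exact: (integral_cst (exponential_law _ r0) measurableT).
  have -> : exponential_law _ r0 setT = 1 by exact: probability_setT.
  by rewrite mule1.
transitivity (\int[counting]_(b in ~` [set a]) (k * (jump_prob a b)%:E)).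
  by apply: eq_integral => b _; rewrite muleC.
rewrite ge0_integralZl//.
- by rewrite [X in k * X]sum_jump_prob mule1.
- exact: hS.2.
- exact: counting_measurable.
- by move=> b /eqP ba; rewrite lee_fin jump_prob_ge0.
Qed.

Lemma jump_mean_ge0 a (f : R -> S -> \bar R) : (forall s b, 0 <= f s b) ->
  0 <= jump_mean a f.
Proof.
move=> f0; apply: sum_neq_ge0 => b ba.
rewrite mule_ge0// ?lee_fin ?jump_prob_ge0//.
exact: (@integral_ge0 _ _ _ (exponential_law _ (rate_gt0 a)) setT).
Qed.

Lemma jump_meanD a (f f' : R -> S -> \bar R) :
  (forall b, measurable_fun setT (f^~ b)) -> (forall s b, 0 <= f s b) ->
  (forall b, measurable_fun setT (f'^~ b)) -> (forall s b, 0 <= f' s b) ->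
  jump_mean a (fun s b => f s b + f' s b) = jump_mean a f + jump_mean a f'.
Proof.
move=> mf f0 mf' f'0; have r0 := rate_gt0 a; rewrite /jump_mean.
have I0 (k : R -> \bar R) : (forall s, 0 <= k s) ->
  0 <= \int[exponential_prob (rate q a)]_s k s.
  by move=> k0; exact: (@integral_ge0 _ _ _ (exponential_law _ r0) setT).
rewrite -[RHS]ge0_integralD//; last 5 first.
- exact: hS.2.
- by move=> b /eqP ba; rewrite mule_ge0 ?I0// lee_fin jump_prob_ge0.
- exact: counting_measurable.
- by move=> b /eqP ba; rewrite mule_ge0 ?I0// lee_fin jump_prob_ge0.
- exact: counting_measurable.
apply: eq_sum_neq => b ba; rewrite -ge0_muleDr ?I0//; congr (_ * _).
exact: (@ge0_integralD _ _ _ (exponential_law _ r0) setT measurableT _ _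
  (fun s _ => f0 s b) (mf b) (fun s _ => f'0 s b) (mf' b)).
Qed.

End JumpMean.

Arguments jump_prob {R dS S} q a b.
Arguments jump_mean {R dS S} q a f.

(** * Stopping at once beats waiting for the next jump *)
Section OneJump.
Local Open Scope ereal_scope.
Context {R : realType} {dS : measure_display} {S : measurableType dS}.
Context (hS : countable_discrete S) {q : S -> S -> R}.
Hypothesis hq : intensity_matrix q.
Context {U : R -> R} {g : S -> R} {c : R}.
Hypothesis hc : (0 < c)%R.
Hypothesis hUincr : forall x y : R, (x < y)%R -> (U x < U y)%R.
Hypothesis hUC1 : continuously_differentiable U.
Context {a : S} {u : R}.
Hypothesis ha : stopping_set q U g c u a.
Local Notation lambda := (@lebesgue_measure R).
Local Notation r := (rate q a).
Local Notation p := (jump_prob q a).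
Local Notation dens := (exponential_density r).

(** Utility of stopping in state b, a time s after the elapsed time u. *)
Definition reward_at (b : S) (s : R) : R := U (g b - c * (u + s)).
Local Notation W := reward_at.

Lemma continuous_utility : continuous U.
Proof.
move=> x; apply: differentiable_continuous; apply/derivable1_diffP.
exact: hUC1.1.
Qed.

Lemma measurable_utility : measurable_fun setT U.
Proof. by apply: continuous_measurable_fun; exact: continuous_utility. Qed.

Lemma measurable_reward_at b : measurable_fun setT (W b).
Proof.
apply: (measurableT_comp measurable_utility).
apply: measurable_funB => //; apply: measurable_funM => //.
exact: measurable_funD.
Qed.

(** Utility for the plan to stop in state a after a further time theta, when the
    next jump comes after time s and leads to b: either the plan is executed
    before the jump, or the reward is evaluated right after the jump. *)
Definition reward_after (theta : \bar R) (s : R) (b : S) : R :=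
  if theta < s%:E then W a (fine theta) else W b s.

(** Mean over the next state of a transform nu of the reward after a jump at
    time s, used with nu the positive and the negative part. *)
Definition mean_reward (nu : R -> R) (s : R) : \bar R :=
  sum_neq a (fun b => (p b)%:E * (nu (W b s))%:E).

Let r0 : (0 < r)%R. Proof. exact: rate_gt0. Qed.

Section Transform.
Variables (nu : R -> R).
Hypothesis mnu : measurable_fun setT nu.
Hypothesis nu0 : forall x, (0 <= nu x)%R.

Lemma mean_reward_ge0 s : 0 <= mean_reward nu s.
Proof.
by apply: sum_neq_ge0 => b ba; rewrite mule_ge0// lee_fin// jump_prob_ge0.
Qed.

Lemma measurable_mean_reward D : measurable_fun D (mean_reward nu).
Proof.
apply: measurable_jump_sum => // [b|s b]; last by rewrite lee_fin.
apply/measurable_EFinP; apply: (measurableT_comp mnu).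
exact: measurable_reward_at.
Qed.

Lemma measurable_mean_reward_dens D :
  measurable_fun D (fun s => mean_reward nu s * (dens s)%:E).
Proof.
apply: emeasurable_funM; first exact: measurable_mean_reward.
by apply/measurable_EFinP; exact: measurable_exponential_density.
Qed.

Lemma mean_reward_dens_ge0 s : 0 <= mean_reward nu s * (dens s)%:E.
Proof.
by rewrite mule_ge0 ?mean_reward_ge0// lee_fin exponential_density_ge0.
Qed.

Lemma measurable_reward_after theta b :
  measurable_fun setT (fun s => (nu (reward_after theta s b))%:E).
Proof.
apply/measurable_EFinP; apply: (measurableT_comp mnu).
apply: measurable_fun_ifT.
- apply: measurable_fun_lte => //; exact: EFin_measurable.
- exact: measurable_cst.
- exact: measurable_reward_at.
Qed.

Lemma jump_mean_never :
  jump_mean q a (fun s b => (nu (reward_after +oo s b))%:E) =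
  \int[lambda]_(s in `[0%R, +oo[) (mean_reward nu s * (dens s)%:E).
Proof.
rewrite (jump_meanE hS hq)// => [b|s b]; last by rewrite lee_fin.
exact: measurable_reward_after.
Qed.

Lemma jump_mean_stop y : (0 <= y)%R ->
  jump_mean q a (fun s b => (nu (reward_after y%:E s b))%:E) =
  \int[lambda]_(s in `[0%R, y]) (mean_reward nu s * (dens s)%:E) +
  (expR (- r * y) * nu (W a y))%:E.
Proof.
move=> y0; rewrite (jump_meanE hS hq)//; last 2 first.
- by move=> b; exact: measurable_reward_after.
- by move=> s b; rewrite lee_fin.
set f := (fun s => _ * _).
have f0 s : 0 <= f s.
  apply: mule_ge0; last by rewrite lee_fin exponential_density_ge0.
  by apply: sum_neq_ge0 => b ba; rewrite mule_ge0// lee_fin// jump_prob_ge0.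
have mf D : measurable_fun D f.
  apply: emeasurable_funM; last first.
    by apply/measurable_EFinP; exact: measurable_exponential_density.
  apply: measurable_jump_sum => // [b|s b]; last by rewrite lee_fin.
  exact: measurable_reward_after.
have fle s : (s <= y)%R -> f s = mean_reward nu s * (dens s)%:E.
  move=> sy; congr (_ * _); apply: eq_sum_neq => b _.
  by rewrite /reward_after lte_fin ltNge sy.
have fgt s : (y < s)%R -> f s = (nu (W a y))%:E * (dens s)%:E.
  move=> ys; rewrite /f; congr (_ * _).
  transitivity (sum_neq a (fun b => (nu (W a y))%:E * (p b)%:E)).
    by apply: eq_sum_neq => b _; rewrite /reward_after lte_fin ys muleC.
  rewrite sum_neqZl// ?(sum_jump_prob hS hq) ?mule1//.
  by move=> b ba; rewrite lee_fin jump_prob_ge0.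
have E : `[0%R, +oo[%classic = `[0%R, y] `|` `]y, +oo[ :> set R.
  apply/seteqP; split => s /=; rewrite !in_itv/= !andbT.
    by move=> s0; case: (leP s y) => ys; [left; rewrite s0|right].
  by case=> [/andP[]//|/ltW]; exact: le_trans.
rewrite E ge0_integral_setU;
  [|exact: measurable_itv|exact: measurable_itv|exact: mf
  |by move=> s _; exact: f0|]; last first.
  apply/disj_setPS => s [] /=; rewrite !in_itv/= andbT => /andP[_ sy].
  by rewrite ltNge sy.
apply: (f_equal2 (fun x1 x2 => x1 + x2)).
  apply: eq_integral => s /[!inE] /=; rewrite in_itv/= => /andP[_ sy].
  exact: fle.
transitivity (\int[lambda]_(s in `]y, +oo[) ((nu (W a y))%:E * (dens s)%:E)).
  apply: eq_integral.
  by move=> s /[!inE] /=; rewrite in_itv/= andbT => ys; exact: fgt.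
rewrite ge0_integralZl_EFin//.
- by rewrite integral_exponential_tail// -EFinM mulrC.
- by move=> s _; rewrite lee_fin exponential_density_ge0.
- by apply/measurable_EFinP; exact: measurable_exponential_density.
Qed.

End Transform.

(** The right-hand side of the condition of [stopping_set] at time u + s. *)
Definition excess_bound (s : R) : R :=
  W a s + c / r * derive1 U (g a - c * (u + s)).

Lemma mean_reward_excess s : (0 <= s)%R ->
  mean_reward posr s - mean_reward negr s <= (excess_bound s)%:E.
Proof.
move=> s0; have := ha (u + s)%R; rewrite lerDl => /(_ s0); apply: le_trans.
rewrite {1}/sum_neq integral_posr_negr le_eqVlt; apply/orP; left; apply/eqP.
congr (_ - _); apply: eq_sum_neq => b ba; have pb := jump_prob_ge0 hq ba.
  by rewrite -EFinM -posrM.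
by rewrite -EFinM -negrM.
Qed.

Lemma mean_reward_le s : (0 <= s)%R ->
  mean_reward posr s + (negr (excess_bound s))%:E <=
  (posr (excess_bound s))%:E + mean_reward negr s.
Proof.
move=> s0; apply: sube_le_posr_negr; last exact: mean_reward_excess.
- exact: mean_reward_ge0 posr_ge0 _.
- exact: mean_reward_ge0 negr_ge0 _.
Qed.

Lemma sum_rate_reward_le s : (0 <= s)%R ->
  sum_neq a (fun b => (q a b)%:E * (W b s)%:E) <= (r * excess_bound s)%:E.
Proof.
move=> s0; have := mean_reward_excess s s0.
have qE b : (q a b = r * p b)%R by rewrite /jump_prob mulrC divfK ?gt_eqF.
have p0 b : b != a -> (0 <= p b)%R by exact: jump_prob_ge0.
have -> : sum_neq a (fun b => (q a b)%:E * (W b s)%:E) =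
    r%:E * mean_reward posr s - r%:E * mean_reward negr s.
  rewrite -!sum_neqZl ?(ltW r0)//; last 2 first.
  - by move=> b ba; rewrite mule_ge0// lee_fin ?negr_ge0 ?p0.
  - by move=> b ba; rewrite mule_ge0// lee_fin ?posr_ge0 ?p0.
  transitivity (sum_neq a (fun b => (r * (p b * W b s))%:E)).
    by apply: eq_sum_neq => b _; rewrite -EFinM qE mulrA.
  rewrite {1}/sum_neq integral_posr_negr; congr (_ - _).
    by apply: eq_sum_neq => b ba; rewrite !posrM ?p0 ?(ltW r0)// !EFinM.
  by apply: eq_sum_neq => b ba; rewrite !negrM ?p0 ?(ltW r0)// !EFinM.
have := mean_reward_ge0 _ posr_ge0 s; have := mean_reward_ge0 _ negr_ge0 s.
case: (mean_reward posr s) => [A| |]//.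
- case: (mean_reward negr s) => [B| |]// _ _.
  + by rewrite -!EFinM -!EFinB !lee_fin -mulrBr ler_pM2l.
  + by move=> _; rewrite gt0_muley ?lte_fin// addeNy leNye.
- case: (mean_reward negr s) => [B| |]// _ _ _.
  by rewrite gt0_muley ?lte_fin// addeNy leNye.
Qed.

Let h s := (expR (- r * s) * (r * U (g a - c * u - c * s) +
  c * derive1 U (g a - c * u - c * s)))%R.

Let densE s : (dens s * excess_bound s)%R = h s.
Proof.
rewrite /h /exponential_density /excess_bound /W.
have -> : (g a - c * u - c * s = g a - c * (u + s))%R by ring.
by field; rewrite gt_eqF.
Qed.

Lemma integral_excess_bound {y} : (0 <= y)%R ->
  \int[lambda]_(s in `[0%R, y]) (dens s * excess_bound s)%:E =
  (W a 0 - expR (- r * y) * W a y)%:E.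
Proof.
move=> y0; under eq_integral do rewrite densE.
rewrite integral_discounted// /W; congr (U _ - _ * U _)%:E; ring.
Qed.

(** The condition of [stopping_set] at the times u + s, integrated over s <= y
    against the law of the next jump. The bound integrates to the difference
    between stopping at once and the contribution of stopping at time y. *)
Lemma integral_mean_reward_le y : (0 <= y)%R ->
  \int[lambda]_(s in `[0%R, y]) (mean_reward posr s * (dens s)%:E) +
    (expR (- r * y) * posr (W a y) + negr (W a 0))%:E <=
  (posr (W a 0) + expR (- r * y) * negr (W a y))%:E +
    \int[lambda]_(s in `[0%R, y]) (mean_reward negr s * (dens s)%:E).
Proof.
move=> y0; set A := integral _ _ _; set B := integral _ _ _.
pose Q := \int[lambda]_(s in `[0%R, y]) (posr (h s))%:E.
pose N := \int[lambda]_(s in `[0%R, y]) (negr (h s))%:E.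
have ch : continuous h by exact: continuous_discounted.
have mh (nu : R -> R) : measurable_fun setT nu ->
    measurable_fun (`[0%R, y] : set R) (fun s => (nu (h s))%:E).
  move=> mnu; apply: measurable_funTS; apply/measurable_EFinP.
  by apply: (measurableT_comp mnu); exact: continuous_measurable_fun.
have ih : lambda.-integrable `[0%R, y] (EFin \o h).
  apply: continuous_compact_integrable; first exact: segment_compact.
  exact: continuous_subspaceT.
have QN : Q - N = (W a 0 - expR (- r * y) * W a y)%:E.
  rewrite -integral_posr_negr integral_discounted//.
  by rewrite /W; congr (U _ - _ * U _)%:E; ring.
have fN : N \is a fin_num.
  suff -> : N = \int[lambda]_(s in `[0%R, y]) (EFin \o h)^\- s.
    exact: integrable_neg_fin_num.
  by apply: eq_integral => s _; rewrite funenegE -EFinN -EFin_max.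
have fQ : Q \is a fin_num.
  suff -> : Q = \int[lambda]_(s in `[0%R, y]) (EFin \o h)^\+ s.
    exact: integrable_pos_fin_num.
  by apply: eq_integral => s _; rewrite funeposE -EFin_max.
have mpos := measurable_mean_reward_dens _ measurable_posr posr_ge0.
have mneg := measurable_mean_reward_dens _ measurable_negr negr_ge0.
have pos0 := mean_reward_dens_ge0 _ posr_ge0.
have neg0 := mean_reward_dens_ge0 _ negr_ge0.
have AB : A + N <= Q + B.
  rewrite -ge0_integralD; [|exact: measurable_itv|by move=> s _; exact: pos0|
    exact: mpos|by move=> s _; rewrite lee_fin negr_ge0|
    exact: mh measurable_negr].
  rewrite -ge0_integralD; [|exact: measurable_itv|
    by move=> s _; rewrite lee_fin posr_ge0|exact: mh measurable_posr|
    by move=> s _; exact: neg0|exact: mneg].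
  apply: le_integral_pointwise => s /=; rewrite in_itv/= => /andP[s0 _].
  have d0 := @exponential_density_ge0 _ _ r0 s.
  rewrite -densE posrM// negrM// !(mulrC (dens s)).
  rewrite !EFinM -!ge0_muleDl//.
  - by apply: lee_wpmul2r (mean_reward_le _ s0); rewrite lee_fin.
  - by rewrite lee_fin posr_ge0.
  - exact: mean_reward_ge0 negr_ge0 _.
  - exact: mean_reward_ge0 posr_ge0 _.
  - by rewrite lee_fin negr_ge0.
have A0 : 0 <= A by apply: integral_ge0 => s _; exact: pos0.
have B0 : 0 <= B by apply: integral_ge0 => s _; exact: neg0.
move: AB QN; rewrite -(fineK fQ) -(fineK fN) => + [].
move: A B A0 B0 => [A| |]// [B| |]// _ _;
  rewrite ?addey ?leey// -?EFinD ?lee_fin.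
have := posr_negr (W a 0); have := posr_negr (W a y).
move: (expR _) => e Ey E0 AB QN.
have : (e * W a y = e * posr (W a y) - e * negr (W a y))%R.
  by rewrite [in LHS]Ey mulrBr.
lra.
Qed.

Lemma mean_reward_ge b s : b != a ->
  (p b)%:E * (negr (W b s))%:E <= mean_reward negr s.
Proof.
move=> ba; rewrite -(@integral_counting_set1 R _ _ hS b
  (fun b => (p b)%:E * (negr (W b s))%:E)).
apply: ge0_subset_integral.
- exact: hS.2.
- exact: hS.2.
- exact: counting_measurable.
- move=> b' /eqP b'a; rewrite mule_ge0// lee_fin ?negr_ge0//.
  exact: jump_prob_ge0.
- by move=> b' ->; exact/eqP.
Qed.

(** If the loss after the next jump is integrable, then the boundary term of
    [integral_mean_reward_le] is negligible along a sequence of times. The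
    rewards in two states differ by a shift of time because U is evaluated at
    g - c * time; so if the term stayed above e, the discounted loss in a
    reachable state b would stay above a positive constant. *)
Lemma discounted_loss_small :
  \int[lambda]_(s in `[0%R, +oo[) (mean_reward negr s * (dens s)%:E) < +oo ->
  forall (e x0 : R), (0 < e)%R -> exists x : R,
    [/\ (0 <= x)%R, (x0 <= x)%R & (expR (- r * x) * negr (W a x) <= e)%R].
Proof.
move=> fin e x0 e0; apply: contrapT => none.
have big x : (0 <= x)%R -> (x0 <= x)%R ->
    (e < expR (- r * x) * negr (W a x))%R.
  by move=> x_ge0 x0x; rewrite ltNge; apply/negP => ex; apply: none; exists x.
have [b [ba pb]] := jump_prob_supported hS hq a.
(* K is a delay that makes the reward in b as bad as the one in a *)
pose K := (`|g b - g a| / c)%R.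
pose L := (posr x0 + K)%R.
pose delta := (p b * e * r * expR (- r * K))%R.
have K0 : (0 <= K)%R by rewrite /K divr_ge0// ltW.
have L0 : (0 <= L)%R by rewrite /L addr_ge0// posr_ge0.
have delta0 : (0 < delta)%R.
  by rewrite /delta mulr_gt0 ?expR_gt0// mulr_gt0// mulr_gt0.
have lb s : (L <= s)%R -> delta%:E <= mean_reward negr s * (dens s)%:E.
  move=> Ls; have d0 := @exponential_density_ge0 _ _ r0 s.
  apply: (@le_trans _ _ ((p b)%:E * (negr (W b s))%:E * (dens s)%:E));
    last first.
    by apply: lee_wpmul2r; [rewrite lee_fin|exact: mean_reward_ge].
  have skx : (posr x0 <= s - K)%R by rewrite lerBrDr.
  have sk0 : (0 <= s - K)%R by apply: le_trans skx; exact: posr_ge0.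
  have skx0 : (x0 <= s - K)%R by apply: le_trans skx; rewrite le_max lexx.
  have WW : (W b s <= W a (s - K))%R.
    have Umono : {homo U : x y / (x <= y)%R} by apply: ltW_homo.
    apply: Umono; have : (g b - g a <= c * K)%R.
      by rewrite /K mulrC divfK ?gt_eqF// ler_norm.
    by move: (K) (g b) (g a) => K' gb ga; nra.
  have := big _ sk0 skx0; rewrite -!EFinM lee_fin => eW.
  have {}eW : (e * expR (- r * K) * expR (r * s) <= negr (W b s))%R.
    apply: le_trans (negr_le _ _ WW).
    have -> : (negr (W a (s - K)) = expR (- r * (s - K)) * negr (W a (s - K)) *
        expR (- r * K) * expR (r * s))%R.
      have : (expR (- r * (s - K)) * expR (- r * K) * expR (r * s) = 1)%R.
        by rewrite -!expRD -[RHS]expR0; congr expR; ring.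
      move: (expR _) (expR _) (expR _) => x y z E.
      by rewrite -[LHS]mulr1 -E; ring.
    by rewrite !ler_pM2r ?expR_gt0// ltW.
  have -> : (delta = p b * (e * expR (- r * K) * expR (r * s)) * dens s)%R.
    rewrite /delta /exponential_density.
    have : (expR (r * s) * expR (- r * s) = 1)%R.
      by rewrite -expRD -[RHS]expR0; congr expR; ring.
    move: (expR (- r * K)) (expR (r * s)) (expR (- r * s)) => x y z yz.
    by rewrite -[LHS]mulr1 -yz; ring.
  by rewrite ler_wpM2r// ler_wpM2l// ltW.
move: fin; apply/negP; rewrite -leNgt.
have pos0 := mean_reward_dens_ge0 _ negr_ge0.
apply: (@le_trans _ _ (\int[lambda]_(s in `[L, +oo[) delta%:E)).
  rewrite integral_cst//= lebesgue_measure_itv/= ltry.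
  by rewrite gt0_muley ?lte_fin.
apply: (@le_trans _ _
  (\int[lambda]_(s in `[L, +oo[) (mean_reward negr s * (dens s)%:E))).
  by apply: le_integral_pointwise => s /=; rewrite in_itv/= andbT; exact: lb.
apply: ge0_subset_integral => //.
- exact: measurable_mean_reward_dens _ measurable_negr negr_ge0 _.
- by move=> s /=; rewrite !in_itv/= !andbT; exact: le_trans.
Qed.

(** Stopping at once in a state of the stopping set is at least as good as any
    plan theta that is reconsidered after the next jump. For finite theta this
    is [integral_mean_reward_le]. For theta = +oo it is trivial if the loss
    after the jump has infinite mean, and otherwise a limit of that lemma along
    times at which the boundary term is small. *)
Lemma jump_mean_reward_le {theta : \bar R} : 0 <= theta ->
  jump_mean q a (fun s b => (posr (reward_after theta s b))%:E) +
    (negr (W a 0))%:E <=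
  (posr (W a 0))%:E +
    jump_mean q a (fun s b => (negr (reward_after theta s b))%:E).
Proof.
have mpos := measurable_mean_reward_dens _ measurable_posr posr_ge0.
have pos0 := mean_reward_dens_ge0 _ posr_ge0.
have neg0 := mean_reward_dens_ge0 _ negr_ge0.
case: theta => [y| _|//].
  rewrite lee_fin => y0.
  rewrite (jump_mean_stop _ measurable_posr posr_ge0 _ y0).
  rewrite (jump_mean_stop _ measurable_negr negr_ge0 _ y0).
  rewrite -addeA -EFinD [X in _ <= _ + X]addeC [X in _ <= X]addeA -EFinD.
  exact: integral_mean_reward_le.
rewrite (jump_mean_never _ measurable_posr posr_ge0).
rewrite (jump_mean_never _ measurable_negr negr_ge0).
set B := (X in _ <= _ + X).
have [->|Bfin] := eqVneq B +oo; first by rewrite addey// leey.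
have {}Bfin : B < +oo by rewrite ltey.
have B0 : 0 <= B by apply: integral_ge0 => s _; exact: neg0.
have fB : B \is a fin_num by rewrite ge0_fin_numE.
set A := (X in X + _ <= _).
suff key e : (0 < e)%R ->
    A <= (posr (W a 0) - negr (W a 0) + fine B + e)%:E.
  rewrite -leeBrDr//.
  have -> : (posr (W a 0))%:E + B - (negr (W a 0))%:E =
      (posr (W a 0) - negr (W a 0) + fine B)%:E.
    by rewrite -[in LHS](fineK fB) -EFinN -!EFinD; congr _%:E; ring.
  by apply/lee_addgt0Pr => e /key; rewrite -EFinD.
move=> e0.
have cv : \int[lambda]_(s in `[0%R, n%:R]) (mean_reward posr s * (dens s)%:E)
    @[n --> \oo] --> A.
  have := @ge0_nondecreasing_set_cvg_integral _ (measurableTypeR R) R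
    (fun n : nat => `[0%R, (n%:R : R)]%classic)
    (fun s => mean_reward posr s * (dens s)%:E) lambda.
  have -> : \bigcup_i `[0%R, (i%:R : R)]%classic = `[0%R, +oo[%classic.
    apply/seteqP; split => s /=; rewrite in_itv/= andbT.
      by move=> [n _] /=; rewrite in_itv/= => /andP[].
    move=> s0; exists (Num.truncn s).+1 => //=; rewrite in_itv/= s0/=.
    by rewrite ltW// truncnS_gt.
  apply.
  - move=> m n mn; apply/subsetPset => s /=; rewrite !in_itv/= => /andP[-> /=].
    by move=> /le_trans; apply; rewrite ler_nat.
  - by move=> n; exact: measurable_itv.
  - by move=> n; exact: mpos.
  - by move=> n s _; exact: pos0.
rewrite -(cvg_lim _ cv)//; apply: lime_le; first by apply/cvg_ex; exists A.
apply: nearW => n.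
have [x [x_ge0 nx ex]] := discounted_loss_small Bfin e n%:R e0.
apply: (@le_trans _ _
  (\int[lambda]_(s in `[0%R, x]) (mean_reward posr s * (dens s)%:E))).
  apply: ge0_subset_integral => //; first exact: mpos.
  by move=> s /=; rewrite !in_itv/= => /andP[-> /=] /le_trans; exact.
have := integral_mean_reward_le _ x_ge0.
have : \int[lambda]_(s in `[0%R, x]) (mean_reward negr s * (dens s)%:E) <= B.
  apply: ge0_subset_integral => //.
    exact: measurable_mean_reward_dens _ measurable_negr negr_ge0 _.
  by move=> s /=; rewrite !in_itv/= andbT => /andP[].
rewrite -(fineK fB).
have : 0 <= \int[lambda]_(s in `[0%R, x]) (mean_reward negr s * (dens s)%:E).
  exact: integral_ge0.
have : 0 <= \int[lambda]_(s in `[0%R, x]) (mean_reward posr s * (dens s)%:E).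
  exact: integral_ge0.
have := mulr_ge0 (expR_ge0 (- r * x)) (posr_ge0 (W a x)).
move: (integral _ _ _) (integral _ _ _) => [A'| |]// [B'| |]// e1.
rewrite -?EFinD !lee_fin => _ _; lra.
Qed.

End OneJump.

Arguments reward_at {R dS S} U g c u b s.
Arguments reward_after {R dS S} U g c a u theta s b.

(** * Integrating out an independent coordinate *)
Section PairDisintegration.
Local Open Scope ereal_scope.
Context {R : realType} {d : measure_display} {Omega : measurableType d}.

Lemma integral_mrestr (mu : {measure set Omega -> \bar R}) {D : set Omega}
    (mD : measurable D) (f : Omega -> \bar R) :
  measurable_fun setT f -> (forall w, 0 <= f w) ->
  \int[mrestr mu mD]_w f w = \int[mu]_(w in D) f w.
Proof.
move=> mf f0; have mDC := measurableC mD.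
rewrite -(setvU D) ge0_integral_setU ?setvU//; last exact/disj_setPCr.
rewrite (@null_set_integral _ _ _ _ (~` D)) ?add0e//.
- apply: eq_measure_integral => A mA AD; rewrite /= /mrestr.
  by congr (mu _); exact/setIidl.
- exact: measurable_funTS.
- by rewrite /= /mrestr setICl measure0.
Qed.

Context {d1 d2 : measure_display}.
Context {T1 : measurableType d1} {T2 : measurableType d2}.
Context (P : probability Omega R) {D E : set Omega}.
Context {X : Omega -> T1} {Y : Omega -> T2} (m : probability T2 R).
Context (k : {nonneg R}%R).
Hypotheses (mD : measurable D) (mE : measurable E).
Hypotheses (mX : measurable_fun setT X) (mY : measurable_fun setT Y).
Hypothesis law : forall (A : set T1) (B : set T2),
  measurable A -> measurable B ->
  P (E `&` X @^-1` A `&` Y @^-1` B) = P (D `&` X @^-1` A) * (k%:num%:E * m B).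

(** The law of X on D, scaled by k. [first_law] is the same set function under a
    name of its own, which carries the finite measure structure. *)
Definition first_measure : {measure set T1 -> \bar R}.
Proof.
refine (pushforward (mscale k (mrestr P mD)) X : measure _ _); exact: mX.
Defined.

Definition first_law : set T1 -> \bar R := first_measure.

HB.instance Definition _ := Measure.copy first_law first_measure.

Lemma first_law_fin : fin_num_fun first_law.
Proof.
move=> A mA; rewrite /first_law /first_measure /= /pushforward /mscale /=.
rewrite /mrestr fin_numM//.
rewrite fin_num_measure//; apply: measurableI => //.
by rewrite -[_ @^-1` _]setTI; exact: mX.
Qed.

HB.instance Definition _ :=
  @Measure_isFinite.Build _ _ _ first_law first_law_fin.

(** By [law] the image of P, restricted to E, under (X, Y) agrees on rectangles
    with the product of [first_law] and m. These measures are finite, so they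
    coincide, and the claim is Tonelli for the product. *)
Lemma integral_pair (f : T1 * T2 -> \bar R) :
  measurable_fun setT f -> (forall z, 0 <= f z) ->
  \int[P]_(w in E) f (X w, Y w) =
  \int[P]_(w in D) (k%:num%:E * \int[m]_s f (X w, s)).
Proof.
move=> mf f0.
have mXY : measurable_fun setT (fun w => (X w, Y w)).
  exact: measurable_fun_pair.
pose mu2' : {measure set (T1 * T2) -> \bar R} :=
  pushforward (mrestr P mE) (fun w => (X w, Y w)).
pose mu2 := mu2' mXY.
pose F x := \int[m]_s f (x, s).
have mF : measurable_fun setT F by exact: measurable_fun_fubini_tonelli_F.
have F0 x : 0 <= F x by apply: integral_ge0 => s _; exact: f0.
have mfXY : measurable_fun setT (fun w => f (X w, Y w)).
  exact: (measurableT_comp mf mXY).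
have mFX : measurable_fun setT (F \o X) by exact: (measurableT_comp mF mX).
have mu2E A : measurable A -> (first_law \x m) A = mu2 A.
  apply: product_measure_unique => A1 A2 mA1 mA2.
  have mXA1 : measurable (X @^-1` A1) by rewrite -[_ @^-1` _]setTI; exact: mX.
  have -> : mu2 (A1 `*` A2) = P (E `&` X @^-1` A1 `&` Y @^-1` A2).
    rewrite /mu2 /= /pushforward /mrestr; congr (P _).
    by rewrite setIC -setIA.
  rewrite law// muleCA muleA; congr (_ * _).
  by rewrite /first_law /= /pushforward /mscale /= /mrestr setIC.
transitivity (\int[mu2]_z f z).
  rewrite -(integral_mrestr P mE)//.
  exact/esym/(ge0_integral_pushforward mXY (mrestr P mE)).
transitivity (\int[first_law \x m]_z f z).
  by apply: eq_measure_integral => A mA _; rewrite -mu2E.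
rewrite fubini_tonelli1//.
transitivity (\int[mscale k (mrestr P mD)]_w F (X w)).
  exact: (ge0_integral_pushforward mX (mscale k (mrestr P mD))).
rewrite ge0_integral_mscale// integral_mrestr// -ge0_integralZl_EFin//.
exact: measurable_funTS.
Qed.

End PairDisintegration.

(** * Observing the jumps *)
Section Jumps.
Context {R : realType} {dO dS : measure_display}.
Context {Omega : measurableType dO} {S : measurableType dS}.
Context {X : R -> Omega -> S} {Sn : nat -> Omega -> R}.
Hypothesis hJ : jump_times X Sn.

Lemma jump_time0 w : Sn 0%N w = 0. Proof. by have [] := hJ w. Qed.

Lemma jump_time_lt k w : Sn k w < Sn k.+1 w. Proof. by have [] := hJ w. Qed.

Lemma jump_time_le {k l} w : (k <= l)%N -> Sn k w <= Sn l w.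
Proof.
elim: l => [|l IH]; first by rewrite leqn0 => /eqP->.
rewrite leq_eqVlt => /predU1P[->//|]; rewrite ltnS => /IH /le_trans; apply.
exact/ltW/jump_time_lt.
Qed.

Lemma jump_time_ge0 k w : 0 <= Sn k w.
Proof. by rewrite -(jump_time0 w) jump_time_le. Qed.

Lemma between_jumps k s w : Sn k w <= s < Sn k.+1 w ->
  X s w = embedded X Sn k w.
Proof. by have [_ _ + _ _] := hJ w; apply. Qed.

Lemma embedded_neq k w : embedded X Sn k.+1 w <> embedded X Sn k w.
Proof. by have [_ _ _ + _] := hJ w => /(_ k)/eqP. Qed.

Lemma current_jump s w : 0 <= s -> exists k, Sn k w <= s < Sn k.+1 w.
Proof.
move=> s0; have [_ _ _ _ /(_ s) ex] := hJ w.
case: (ex_minnP ex) => -[|k]; first by rewrite jump_time0 ltNge s0.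
move=> sk min; exists k; rewrite sk andbT leNgt; apply/negP => /min.
by rewrite ltnn.
Qed.

End Jumps.

Section Grid.
Context {R : realType}.

(** A countable set of times that suffices to see what happened up to time s:
    the rational times, and s itself in case a jump takes place exactly then. *)
Definition grid (s : R) (o : option rat) : R :=
  if o is Some x then ratr x else s.

Lemma grid_dense {s x y : R} : x <= s -> x < y ->
  exists o, [/\ x <= grid s o, grid s o <= s & grid s o < y].
Proof.
rewrite le_eqVlt => /predU1P[-> sy|xs xy]; first by exists None; split.
have : x < Num.min s y by rewrite lt_min xs.
move=> /rat_in_itvoo[v]; rewrite in_itv/= lt_min => /and3P[xv vs vy].
by exists (Some v); rewrite /= !ltW.
Qed.

End Grid.

(** W is any measurable space on which X is measurable up to time r only. It is
    used for the sample space itself and for the sample space with the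
    sigma-algebra generated by X up to time r. *)
Section Observation.
Context {R : realType} {dW dS : measure_display}.
Context {W : measurableType dW} {S : measurableType dS}.
Hypothesis hS : countable_discrete S.
Context {X : R -> W -> S} {Sn : nat -> W -> R}.
Hypothesis hJ : jump_times X Sn.
Context {r : R}.
Hypothesis r0 : 0 <= r.
Hypothesis mX : forall s, 0 <= s <= r -> measurable_fun setT (X s).

Lemma measurable_observed s (B : set S) : 0 <= s <= r ->
  measurable (X s @^-1` B).
Proof.
by move=> sr; rewrite -[_ @^-1` _]setTI; apply: mX => //; exact: hS.2.
Qed.

Lemma measurable_state_change s1 s2 : 0 <= s1 <= r -> 0 <= s2 <= r ->
  measurable [set w | X s1 w <> X s2 w].
Proof.
move=> h1 h2.
rewrite (_ : [set _ | _] = \bigcup_(a : S)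
    (X s1 @^-1` [set a] `&` ~` (X s2 @^-1` [set a]))); last first.
  apply/seteqP; split => w /=.
    by move=> neq; exists (X s1 w) => //; split => // e; apply: neq.
  by move=> [a _ [/= <-]] neq e; apply: neq.
apply: countable_bigcupT_measurable; first exact: hS.1.
move=> a; apply: measurableI; first exact: measurable_observed.
by apply: measurableC; exact: measurable_observed.
Qed.

(** There are at least k + 1 jumps up to time s if and only if X takes different
    values at two grid times, the first of which is not before the k-th jump. *)
Lemma measurable_jumped k s : 0 <= s <= r -> measurable [set w | Sn k w <= s].
Proof.
elim: k s => [|k IH] s /andP[s0 sr].
  rewrite (_ : [set _ | _] = setT)//; apply/seteqP; split => // w _ /=.
  by rewrite (jump_time0 hJ).
pose ok (o : option rat * option rat) :=
  [&& 0 <= grid s o.1, grid s o.1 <= grid s o.2 & grid s o.2 <= s].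
rewrite (_ : [set _ | _] = \bigcup_(o : option rat * option rat)
   (if ok o then [set w | Sn k w <= grid s o.1] `&`
      [set w | X (grid s o.1) w <> X (grid s o.2) w] else set0)); last first.
  apply/seteqP; split => w /=.
    move=> Sks; have ltk := jump_time_lt hJ k w.
    have [v1 [le1 les1 lt1]] := grid_dense (le_trans (ltW ltk) Sks) ltk.
    have [v2 [le2 les2 lt2]] := grid_dense Sks (jump_time_lt hJ k.+1 w).
    exists (v1, v2); first by []; rewrite /ok /= les2 andbT.
    rewrite (le_trans _ le1) ?(jump_time_ge0 hJ)//=.
    rewrite (ltW (lt_le_trans lt1 le2)); split => //=.
    rewrite (between_jumps hJ k) ?le1//.
    rewrite (between_jumps hJ k.+1) ?le2// => e.
    exact: (embedded_neq hJ k w (esym e)).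
  move=> [v _]; case: ifPn => // /and3P[v0 v12 v2s] [/= Sko neq].
  rewrite leNgt; apply/negP => sSk; apply: neq.
  rewrite (between_jumps hJ k).
    rewrite (between_jumps hJ k)// (le_trans Sko)//=.
    exact: le_lt_trans sSk.
  by rewrite Sko/= (le_lt_trans v12)// (le_lt_trans v2s).
apply: countable_bigcupT_measurable; first exact: countableP.
move=> o; case: ifPn => // /and3P[v0 v12 v2s].
have le1 : grid s o.1 <= r by apply: le_trans sr; exact: le_trans v2s.
apply: measurableI; first by apply: IH; rewrite v0.
apply: measurable_state_change; first by rewrite v0.
by rewrite (le_trans v0)//= (le_trans v2s).
Qed.

Lemma measurable_jumped_into k s (B : set S) : 0 <= s <= r ->
  measurable ([set w | Sn k w <= s] `&` embedded X Sn k @^-1` B).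
Proof.
move=> /andP[s0 sr].
rewrite (_ : _ `&` _ = \bigcup_(o : option rat)
   (if 0 <= grid s o <= s then [set w | Sn k w <= grid s o] `&`
      ~` [set w | Sn k.+1 w <= grid s o] `&` X (grid s o) @^-1` B
    else set0)); last first.
  apply/seteqP; split => w /=.
    move=> [Sks Bk].
    have [v [le1 les1 lt1]] := grid_dense Sks (jump_time_lt hJ k w).
    exists v; first by []; rewrite les1 (le_trans _ le1) ?(jump_time_ge0 hJ)//=.
    split; first by split => //; apply/negP; rewrite -ltNge.
    by rewrite (between_jumps hJ k) ?le1.
  move=> [v _]; case: ifPn => // /andP[v0 os] [[/= Sko /negP]].
  rewrite -ltNge => oS; rewrite (between_jumps hJ k) ?Sko// => Bk.
  by split => //; exact: le_trans os.
apply: countable_bigcupT_measurable; first exact: countableP.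
move=> o; case: ifPn => // /andP[v0 os].
have or : 0 <= grid s o <= r by rewrite v0 (le_trans os).
apply: measurableI; last exact: measurable_observed.
apply: measurableI; first exact: measurable_jumped.
by apply: measurableC; exact: measurable_jumped.
Qed.

(** The jump times and the states at jumps as far as they are known at time r.
    Up to that time they are the true ones. *)
Definition seen_time k (w : W) : R := Num.min (Sn k w) r.
Definition seen_state k (w : W) : S := X (seen_time k w) w.

Lemma measurable_seen_time k : measurable_fun setT (seen_time k).
Proof.
apply: (@measurability _ _ W (measurableTypeR R) _ _ _
  (RGenOInfty.measurableE R)).
move=> _ [_ [x ->] <-]; rewrite setTI.
rewrite (_ : _ @^-1` _ = if x < r then
    (if 0 <= x then ~` [set w | Sn k w <= x] else setT) else set0).
  case: ifPn => // xr; case: ifPn => // x0; apply: measurableC.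
  by apply: measurable_jumped; rewrite x0 ltW.
apply/seteqP; split => w /=; rewrite in_itv/= andbT lt_min.
  move=> /andP[xS xr]; rewrite xr; case: ifPn => // x0.
  by apply/negP; rewrite -ltNge.
case: ifPn => // xr; case: ifPn => [x0 /negP|]; first by rewrite -ltNge => ->.
by rewrite -ltNge => x0 _; rewrite (lt_le_trans x0) ?(jump_time_ge0 hJ).
Qed.

Lemma measurable_seen_state k : measurable_fun setT (seen_state k).
Proof.
move=> _ B _; rewrite setTI.
rewrite (_ : _ @^-1` B = ([set w | Sn k w <= r] `&` embedded X Sn k @^-1` B) `|`
    (~` [set w | Sn k w <= r] `&` X r @^-1` B)).
  apply: measurableU; first by apply: measurable_jumped_into; rewrite r0 lexx.
  apply: measurableI; last by apply: measurable_observed; rewrite r0 lexx.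
  by apply: measurableC; apply: measurable_jumped; rewrite r0 lexx.
apply/seteqP; split => w /=; rewrite /seen_state /seen_time /embedded.
  case: (leP (Sn k w) r) => Skr Bw; first by left.
  by right; split => //; apply/negP; rewrite -ltNge.
by case: (leP (Sn k w) r) => Skr [[]|[]].
Qed.

End Observation.

Arguments seen_time {R dW W} Sn r k w.
Arguments seen_state {R dW dS W S} X Sn r k w.

(** * Markovian stopping rules *)
Section StoppingRules.
Context {R : realType} {dS : measure_display} {S : measurableType dS}.
Context {h : nat -> R * S -> \bar R} {t : R}.
Hypothesis mh : forall k, measurable_fun [set x : R * S | 0 <= x.1] (h k).
Hypothesis h0 : forall k x, 0 <= x.1 -> (0 <= h k x)%E.
Hypothesis t0 : 0 <= t.

Lemma measurable_nonneg_time : measurable [set x : R * S | 0 <= x.1].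
Proof.
rewrite (_ : [set _ | _] = fst @^-1` `[0, +oo[%classic); last first.
  by apply/seteqP; split => x /=; rewrite in_itv/= andbT.
by rewrite -[_ @^-1` _]setTI; exact: measurable_fst.
Qed.

Section Measurability.
Context {dW : measure_display} {W : measurableType dW}.

Lemma measurable_rule k {s : W -> R} {z : W -> S} :
  measurable_fun setT s -> measurable_fun setT z -> (forall w, 0 <= s w) ->
  measurable_fun setT (fun w => (s w)%:E + h k (t + s w, z w)%R)%E.
Proof.
move=> ms mz s0; apply: emeasurable_funD; first exact/measurable_EFinP.
apply: (@measurable_comp _ _ _ _ _ _ [set x : R * S | 0 <= x.1] (h k) setT
  (fun w => (t + s w, z w))).
- exact: measurable_nonneg_time.
- by move=> _ [w _ <-] /=; rewrite addr_ge0.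
- exact: mh.
- apply: measurable_fun_pair => //.
  by apply: measurable_funD => //; exact: measurable_cst.
Qed.

Context {X : R -> W -> S} {Sn : nat -> W -> R}.
Hypothesis hJ : jump_times X Sn.

(** The event that the stopping time is not before the n-th jump, in a recursive
    form that suits proofs of measurability by induction. *)
Fixpoint alive n w : bool :=
  if n is m.+1 then alive m w && ~~ stops_before X Sn h t w m else true.

Lemma aliveP n w :
  reflect (forall k, (k < n)%N -> ~~ stops_before X Sn h t w k) (alive n w).
Proof.
elim: n => [|n IH] /=; first by constructor.
apply: (iffP andP) => [[/IH al sn] k|al].
  by rewrite ltnS leq_eqVlt => /predU1P[->//|]; exact: al.
by split; [apply/IH => k kn; apply: al; exact: ltnW|exact: al].
Qed.

Lemma measurable_candidate n :
  measurable_fun setT (Sn n) -> measurable_fun setT (embedded X Sn n) ->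
  measurable_fun setT (candidate X Sn h t n).
Proof.
by move=> mS mZ; apply: measurable_rule => // w; exact: (jump_time_ge0 hJ).
Qed.

Lemma measurable_stops_before n :
  measurable_fun setT (Sn n) -> measurable_fun setT (Sn n.+1) ->
  measurable_fun setT (embedded X Sn n) ->
  measurable_fun setT (fun w => stops_before X Sn h t w n).
Proof.
move=> mS mS' mZ; apply: measurable_fun_lte; first exact: measurable_candidate.
exact/measurable_EFinP.
Qed.

Lemma measurable_alive n :
  (forall k, (k <= n)%N -> measurable_fun setT (Sn k)) ->
  (forall k, (k <= n)%N -> measurable_fun setT (embedded X Sn k)) ->
  measurable_fun setT (alive n).
Proof.
elim: n => [|n IH] mS mZ; first exact: measurable_cst.
apply: measurable_and.
  by apply: IH => k kn; [apply: mS|apply: mZ]; exact: leqW.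
apply: measurable_neg; apply: measurable_stops_before.
- by apply: mS; exact: leqW.
- exact: mS.
- by apply: mZ; exact: leqW.
Qed.

End Measurability.

Arguments alive {dW W} X Sn n w.

Section Paths.
Context {dO : measure_display} {Omega : measurableType dO}.
Context {X : R -> Omega -> S} {Sn : nat -> Omega -> R}.
Hypothesis hJ : jump_times X Sn.
Local Notation tau := (markovian_time X Sn h t).
Local Notation stops := (stops_before X Sn h t).
Local Notation cand := (candidate X Sn h t).

Lemma candidate_ge k w : ((Sn k w)%:E <= cand k w)%E.
Proof.
rewrite /candidate leeDl// h0//= addr_ge0//; exact: (jump_time_ge0 hJ).
Qed.

Variant markovian_time_spec w : \bar R -> Type :=
| StopsAt k of stops w k & (forall j, (j < k)%N -> ~~ stops w j) :
    markovian_time_spec w (cand k w)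
| StopsNever of (forall k, ~~ stops w k) : markovian_time_spec w +oo%E.

Lemma markovian_timeP w : markovian_time_spec w (tau w).
Proof.
rewrite /markovian_time; case: pselect => [ex|none].
  case: ex_minnP => k sk min; constructor => // j; rewrite ltnNge.
  by apply: contra => /min.
by constructor => k; apply/negP => sk; apply: none; exists k.
Qed.

(** If the rule already stops in an earlier period, it does so before the k-th
    jump, which is not after the k-th candidate. *)
Lemma markovian_time_le {k w} : stops w k -> (tau w <= cand k w)%E.
Proof.
move=> sk; case: markovian_timeP => [j sj minj|/(_ k)]; last by rewrite sk.
have : (j <= k)%N by rewrite leqNgt; apply/negP => /minj; rewrite sk.
rewrite leq_eqVlt => /predU1P[->//|jk]; apply: le_trans (ltW sj) _.
apply: le_trans (candidate_ge k w); rewrite lee_fin; exact: (jump_time_le hJ).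
Qed.

Lemma markovian_time_ge0 w : (0 <= tau w)%E.
Proof.
case: markovian_timeP => [k _ _|_]; last exact: leey.
apply: le_trans (candidate_ge k w); rewrite lee_fin; exact: (jump_time_ge0 hJ).
Qed.

Lemma alive_min n w : alive X Sn n w ->
  Order.min (tau w) (Sn n w)%:E = (Sn n w)%:E.
Proof.
move=> /aliveP al; apply/min_idPr.
case: markovian_timeP => [k sk _|_]; last exact: leey.
have nk : (n <= k)%N by rewrite leqNgt; apply/negP => /al; rewrite sk.
apply: le_trans (candidate_ge k w); rewrite lee_fin; exact: (jump_time_le hJ).
Qed.

Lemma stopped_min n w : ~~ alive X Sn n w ->
  Order.min (tau w) (Sn n w)%:E = tau w.
Proof.
move=> al; have [k [kn sk]] : exists k, (k < n)%N /\ stops w k.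
  apply: contrapT => none; move/negP: al; apply; apply/aliveP => k kn.
  by apply/negP => sk; apply: none; exists k.
apply/min_idPl; apply: le_trans (markovian_time_le sk) _.
by apply: le_trans (ltW sk) _; rewrite lee_fin; exact: (jump_time_le hJ).
Qed.

Lemma stopping_min {n w} : alive X Sn n w -> stops w n ->
  Order.min (tau w) (Sn n.+1 w)%:E = cand n w.
Proof.
move=> /aliveP al sn.
case: markovian_timeP => [k sk mink|/(_ n)]; last by rewrite sn.
have -> : k = n.
  apply/eqP; rewrite eqn_leq; apply/andP; split; rewrite leqNgt; apply/negP.
    by move=> /mink; rewrite sn.
  by move=> /al; rewrite sk.
by apply/min_idPl; exact: ltW.
Qed.

End Paths.
End StoppingRules.

Arguments alive {R dS S} h t {dW W} X Sn n w.

(** * Markovian times are stopping times *)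
Section NaturalFiltration.
Context {R : realType} {dO dS : measure_display}.
Context {Omega : measurableType dO} {S : measurableType dS}.
Hypothesis hS : countable_discrete S.
Context {X : R -> Omega -> S} {Sn : nat -> Omega -> R}.
Hypothesis hJ : jump_times X Sn.
Context {h : nat -> R * S -> \bar R} {t : R}.
Hypothesis mh : forall k, measurable_fun [set x : R * S | 0 <= x.1] (h k).
Hypothesis h0 : forall k x, 0 <= x.1 -> (0 <= h k x)%E.
Hypothesis t0 : 0 <= t.
Local Notation tau := (markovian_time X Sn h t).
Local Notation stops := (stops_before X Sn h t).
Local Notation cand := (candidate X Sn h t).

(** The generators of [natural_filtration X r]. Given this name they make the
    sample space a measurable space whose measurable sets are that
    sigma-algebra. *)
Definition observed_events (r : R) : set (set Omega) :=
  [set A | exists2 s : R, 0 <= s <= r & exists B : set S, A = X s @^-1` B].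

(** Let k be the number of jumps up to time r. Then tau <= r if and only if the
    rule stops in one of the periods before the k-th jump, or its candidate of
    the current period is at most r. Both are decided by the jump times and
    states known at time r. *)
Lemma markovian_time_adapted r : 0 <= r ->
  natural_filtration X r [set w | (tau w <= r%:E)%E].
Proof.
move=> r0; pose W := g_sigma_algebraType (observed_events r).
pose XW : R -> W -> S := X; pose SW : nat -> W -> R := Sn.
have mX s : 0 <= s <= r -> measurable_fun setT (XW s).
  move=> sr _ B _; rewrite setTI; apply: sub_sigma_algebra.
  by exists s => //; exists B.
have hJW : jump_times XW SW by exact: hJ.
pose s := seen_time SW r; pose z := seen_state XW SW r.
have ms k : measurable_fun setT (s k) by exact: (measurable_seen_time hS hJW).
have mz k : measurable_fun setT (z k) by exact: (measurable_seen_state hS hJW).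
have s0 k w : 0 <= s k w.
  by rewrite /s /seen_time le_min r0 (jump_time_ge0 hJW).
pose cs k (w : W) := ((s k w)%:E + h k (t + s k w, z k w)%R)%E.
have mcs k : measurable_fun setT (cs k) by exact: measurable_rule.
have sE k w : Sn k w <= r -> s k w = Sn k w by move=> kr; exact/min_idPl.
have csE k w : Sn k w <= r -> cs k w = cand k w.
  by move=> kr; rewrite /cs /z /seen_state -/s sE.
have mr k : measurable [set w : W | SW k w <= r].
  by apply: (measurable_jumped hS hJW mX); rewrite r0 lexx.
suff -> : [set w | (tau w <= r%:E)%E] = \bigcup_k
    ([set w | SW k w <= r] `&` ~` [set w | SW k.+1 w <= r] `&`
      ((\bigcup_(j in [set j | (j < k)%N]) [set w | (cs j w < (s j.+1 w)%:E)%E])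
        `|` [set w | (cs k w <= r%:E)%E])).
  change (measurable (\bigcup_k
    ([set w : W | SW k w <= r] `&` ~` [set w | SW k.+1 w <= r] `&`
      ((\bigcup_(j in [set j | (j < k)%N]) [set w | (cs j w < (s j.+1 w)%:E)%E])
        `|` [set w | (cs k w <= r%:E)%E])))).
  apply: bigcupT_measurable => k; apply: measurableI.
    by apply: measurableI => //; exact: measurableC.
  apply: measurableU.
    apply: bigcup_measurable => j _; rewrite -[X in measurable X]setTI.
    by apply: measurable_lte => //; exact/measurable_EFinP.
  rewrite -[X in measurable X]setTI.
  by apply: measurable_lee => //; exact: measurable_cst.
apply/seteqP; split => w /=.
  move=> taur; have [k /andP[kr rk]] := current_jump hJ r w r0.
  exists k => //; split; first by split => //; apply/negP; rewrite -ltNge.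
  move: taur; case: markovian_timeP => [j sj _ jr|_]; last by rewrite leye_eq.
  have Sjr : Sn j w <= r.
    by rewrite -lee_fin; apply: le_trans jr; exact: (candidate_ge h0 t0 hJ).
  have : (j <= k)%N.
    rewrite leqNgt; apply/negP => kj.
    have := lt_le_trans rk (jump_time_le hJ w kj).
    by rewrite ltNge Sjr.
  rewrite leq_eqVlt => /predU1P[<-|jk]; first by right; rewrite /= csE.
  left; exists j => //=; rewrite csE// sE//.
  exact: le_trans (jump_time_le hJ w jk) kr.
move=> [k _ [[kr /negP]]]; rewrite -ltNge => rk [[j jk /= sj]|/= ck].
  have Sj1r : Sn j.+1 w <= r by exact: le_trans (jump_time_le hJ w jk) kr.
  have Sjr : Sn j w <= r by exact: le_trans (ltW (jump_time_lt hJ j w)) Sj1r.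
  move: sj; rewrite csE// sE// => sj.
  apply: le_trans (markovian_time_le h0 t0 hJ sj) _.
  by apply: le_trans (ltW sj) _; rewrite lee_fin.
move: ck; rewrite csE// => ck.
have sk : stops w k by apply: le_lt_trans ck _; rewrite lte_fin.
exact: le_trans (markovian_time_le h0 t0 hJ sk) ck.
Qed.

End NaturalFiltration.

(** * The law of the next jump *)
Section ChainLaw.
Context {R : realType} {dO dS : measure_display}.
Context {Omega : measurableType dO} {S : measurableType dS}.
Hypothesis hS : countable_discrete S.
Context {q : S -> S -> R} {X : R -> Omega -> S} {Sn : nat -> Omega -> R}.
Context {P : S -> probability Omega R}.
Hypothesis hX : markov_chain q X Sn P.
Local Notation Z := (embedded X Sn).

Lemma chain_intensity : intensity_matrix q. Proof. by have [] := hX. Qed.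
Lemma chain_jumps : jump_times X Sn. Proof. by have [] := hX. Qed.
Lemma measurable_chain s : 0 <= s -> measurable_fun setT (X s).
Proof. by have [_ + _ _ _] := hX; exact. Qed.
Lemma measurable_jump_time n : measurable_fun setT (Sn n).
Proof. by have [_ _ + _ _] := hX; exact. Qed.

Lemma measurable_embedded n : measurable_fun setT (Z n).
Proof.
move=> _ B _; rewrite setTI.
rewrite (_ : _ @^-1` B = \bigcup_m ([set w | Sn n w <= m%:R] `&` Z n @^-1` B)).
  apply: bigcupT_measurable => m.
  apply: (measurable_jumped_into hS chain_jumps (r := m%:R)).
    move=> s /andP[s0 _].
    exact: measurable_chain.
  by rewrite ler0n lexx.
apply/seteqP; split => w /=; last by case=> m _ [].
move=> Bw; exists (Num.truncn (Sn n w)).+1 => //=; split => //.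
by rewrite ltW// truncnS_gt.
Qed.

Lemma measurable_embedded_eq n a : measurable (Z n @^-1` [set a]).
Proof.
by rewrite -[_ @^-1` _]setTI; apply: measurable_embedded => //; exact: hS.2.
Qed.

(** The generators of [history X Sn n], named for the same purpose. *)
Definition history_events n : set (set Omega) :=
  [set A | exists2 m : nat, (m <= n)%N &
    (exists B : set S, A = Z m @^-1` B) \/
    (exists2 B : set R, measurable B & A = Sn m @^-1` B)].

Lemma history_measurable {n A} : history X Sn n A -> measurable A.
Proof.
suff sub : history X Sn n `<=` measurable by exact: sub.
apply: smallest_sub; first exact: sigma_algebra_measurable.
move=> _ [m _ [[B ->]|[B mB ->]]].
  rewrite -[X in measurable X]setTI; apply: measurable_embedded => //.
  exact: hS.2.
by rewrite -[X in measurable X]setTI; exact: measurable_jump_time.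
Qed.

Lemma historyI {n A B} : history X Sn n A -> history X Sn n B ->
  history X Sn n (A `&` B).
Proof. exact: (@measurableI _ (g_sigma_algebraType (history_events n))). Qed.

Lemma history_jump_time {n} {B : set R} : measurable B ->
  history X Sn n (Sn n @^-1` B).
Proof.
by move=> mB; apply: sub_sigma_algebra; exists n => //; right; exists B.
Qed.

Lemma history_alive {h : nat -> R * S -> \bar R} {t : R} {n} :
  (forall k, measurable_fun [set x : R * S | 0 <= x.1] (h k)) ->
  0 <= t ->
  history X Sn n [set w | alive h t X Sn n w].
Proof.
move=> mh t0; pose W := g_sigma_algebraType (history_events n).
pose XW : R -> W -> S := X; pose SW : nat -> W -> R := Sn.
have hJW : jump_times XW SW by exact: chain_jumps.
have mS k : (k <= n)%N -> measurable_fun setT (SW k).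
  move=> kn _ B mB; rewrite setTI; apply: sub_sigma_algebra.
  by exists k => //; right; exists B.
have mZ k : (k <= n)%N -> measurable_fun setT (embedded XW SW k).
  move=> kn _ B mB; rewrite setTI; apply: sub_sigma_algebra.
  by exists k => //; left; exists B.
have := measurable_alive mh t0 hJW n mS mZ.
by move=> /(_ measurableT [set true] Logic.I); rewrite setTI.
Qed.

(** Given a past event on which the chain sits in state a, the holding time and
    the next state are averaged out by [jump_mean]; the time of the last jump is
    kept. For each possible next state b this is [integral_pair], whose
    hypothesis on rectangles is the defining property of the chain. *)
Lemma integral_jump (i : S) (n : nat) (a : S) (A : set Omega)
    (F : R -> R -> S -> \bar R) :
  history X Sn n A ->
  (forall b, measurable_fun setT (fun z : R * R => F z.1 z.2 b)) ->
  (forall v s b, 0 <= F v s b)%E ->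
  (\int[P i]_(w in A `&` Z n @^-1` [set a])
     F (Sn n w) (Sn n.+1 w - Sn n w)%R (Z n.+1 w) =
   \int[P i]_(w in A `&` Z n @^-1` [set a]) jump_mean q a (F (Sn n w)))%E.
Proof.
move=> hA mF F0; set D := A `&` _; set T := fun w => (Sn n.+1 w - Sn n w)%R.
have mT : measurable_fun setT T.
  by apply: measurable_funB; exact: measurable_jump_time.
have mD : measurable D.
  apply: measurableI; first exact: history_measurable hA.
  exact: measurable_embedded_eq.
have hq := chain_intensity; have r0 := rate_gt0 hq a.
pose m : probability (measurableTypeR R) R := exponential_law _ r0.
have mFn b : measurable_fun setT (fun w => F (Sn n w) (T w) b).
  apply: (measurableT_comp (mF b) (measurable_fun_pair _ _)) => //.
  exact: measurable_jump_time.
have pairs b : b != a ->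
    (\int[P i]_(w in D `&` Z n.+1 @^-1` [set b]) F (Sn n w) (T w) (Z n.+1 w) =
     \int[P i]_(w in D) ((jump_prob q a b)%:E * \int[m]_s F (Sn n w) s b))%E.
  move=> ba.
  transitivity
    (\int[P i]_(w in D `&` Z n.+1 @^-1` [set b]) F (Sn n w) (T w) b)%E.
    by apply: eq_integral => w /[!inE] -[_ /= ->].
  pose k := NngNum (jump_prob_ge0 hq ba).
  apply: (@integral_pair _ _ _ _ _ (measurableTypeR R) (measurableTypeR R)
    (P i) D _ (Sn n) T m k mD _ (measurable_jump_time n) mT _
    (fun z => F z.1 z.2 b)) => //.
  - by apply: measurableI => //; exact: measurable_embedded_eq.
  - move=> C B mC mB; have [_ _ _ _ /(_ i)[_ law]] := hX.
    have := law n (A `&` Sn n @^-1` C) a b B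
      (historyI hA (history_jump_time mC)).
    rewrite eq_sym => /(_ ba mB) lawE.
    transitivity (P i (A `&` Sn n @^-1` C `&` [set w | Z n w = a] `&`
        [set w | Z n.+1 w = b] `&` [set w | B (Sn n.+1 w - Sn n w)])).
      by congr (P i _); apply/seteqP; split => w /=; rewrite /D /=; tauto.
    rewrite lawE; congr (P i _ * _)%E.
    by apply/seteqP; split => w /=; rewrite /D /=; tauto.
  - exact: (mF b).
pose G w := F (Sn n w) (T w) (Z n.+1 w).
have mG : measurable_fun setT G.
  exact: (measurable_fun_discrete hS mFn (measurable_embedded n.+1)).
have G0 w : (0 <= G w)%E by exact: F0.
transitivity (\int[P i]_(w in D) G w)%E; first by [].
have mGD : measurable_fun D G by exact: measurable_funTS.
rewrite (integral_fibers hS (P i) mD (measurable_embedded n.+1) mGD G0).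
transitivity (sum_neq a (fun b =>
    \int[P i]_(w in D `&` Z n.+1 @^-1` [set b]) G w))%E.
  rewrite /sum_neq [RHS]integral_mkcond; apply: eq_integral => b _.
  rewrite patchE; case: ifPn => //; rewrite notin_setE /= => /contrapT ->.
  rewrite (_ : _ `&` _ = set0) ?integral_set0//.
  apply/seteqP; split => // w [[_ /= Zn]].
  by move=> Zn1; apply: (embedded_neq chain_jumps n w); rewrite Zn Zn1.
have jE w : jump_mean q a (F (Sn n w)) =
    sum_neq a (fun b =>
      (posr (jump_prob q a b))%:E * \int[m]_s F (Sn n w) s b)%E.
  apply: eq_sum_neq => b ba.
  by rewrite /posr max_l// jump_prob_ge0.
under [RHS]eq_integral do rewrite jE.
rewrite [RHS](integral_counting_exchange hS (P i)
  (E := ~` [set a]) (f := fun w b =>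
  ((posr (jump_prob q a b))%:E * \int[m]_s F (Sn n w) s b)%E) mD _ _).2.
- apply: eq_sum_neq => b ba; rewrite pairs//.
  by rewrite /posr max_l// jump_prob_ge0.
- move=> b _; apply: measurable_funTS; apply: measurable_funeM.
  apply: (@measurableT_comp _ _ _ _ _ _ (fun v => \int[m]_s F v s b)%E).
    apply: (@measurable_fun_fubini_tonelli_F _ _ _ (measurableTypeR R) R m
      (fun z => F z.1 z.2 b)).
      exact: mF.
    by move=> z; exact: F0.
  exact: measurable_jump_time.
- move=> w b; rewrite mule_ge0 ?lee_fin ?posr_ge0//; exact: integral_ge0.
Qed.

End ChainLaw.

Arguments history_events {R dO dS Omega S} X Sn n.

(** * The reward stopped at the jump times *)
Section StoppedReward.
Context {R : realType} {dO dS : measure_display}.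
Context {Omega : measurableType dO} {S : measurableType dS}.
Hypothesis hS : countable_discrete S.
Context {q : S -> S -> R} {X : R -> Omega -> S} {Sn : nat -> Omega -> R}.
Context {P : S -> probability Omega R}.
Hypothesis hX : markov_chain q X Sn P.
Context {U : R -> R} {g : S -> R} {c : R}.
Hypothesis hUC1 : continuously_differentiable U.
Context {h : nat -> R * S -> \bar R} {t : R}.
Hypothesis mh : forall k, measurable_fun [set x : R * S | 0 <= x.1] (h k).
Hypothesis h0 : forall k x, 0 <= x.1 -> (0 <= h k x)%E.
Hypothesis t0 : 0 <= t.
Local Notation Z := (embedded X Sn).
Local Notation tau := (markovian_time X Sn h t).
Local Notation stops := (stops_before X Sn h t).
Local Notation cand := (candidate X Sn h t).
Local Notation alive := (alive h t X Sn).

Definition stopped_reward (n : nat) (w : Omega) : R :=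
  payoff X U g c t (fun w => Order.min (tau w) (Sn n w)%:E) w.
Local Notation M := stopped_reward.

Let hJ : jump_times X Sn := chain_jumps hX.

Lemma stopped_reward_alive n w : alive n w ->
  M n w = reward_at U g c (t + Sn n w) (Z n w) 0.
Proof.
move=> al; rewrite /M /payoff (alive_min h0 t0 hJ)//=.
by rewrite /reward_at addr0.
Qed.

Lemma stopped_reward_const n w : ~~ alive n w -> M n.+1 w = M n w.
Proof.
move=> al; rewrite /M /payoff !(stopped_min h0 t0 hJ)//=.
by rewrite negb_and al.
Qed.

(** As long as the rule has not stopped, one step of the stopped reward has
    exactly the form treated by [jump_mean_reward_le]. *)
Lemma stopped_reward_next n w : alive n w ->
  M n.+1 w = reward_after U g c (Z n w) (t + Sn n w)
    (h n (t + Sn n w, Z n w)) (Sn n.+1 w - Sn n w) (Z n.+1 w).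
Proof.
move=> al; have Sn0 := jump_time_ge0 hJ n w.
have hn0 : (0 <= h n (t + Sn n w, Z n w)%R)%E by apply: h0; exact: addr_ge0.
have stopE : stops w n =
    (h n (t + Sn n w, Z n w)%R < (Sn n.+1 w - Sn n w)%:E)%E.
  by rewrite /stops_before /candidate EFinB lteBrDl.
rewrite /reward_after -stopE; case: ifPn => sn.
  rewrite /M /payoff (stopping_min al sn).
  move: sn; rewrite /stops_before /candidate.
  case: (h n _) hn0 => [y| |]// y0; rewrite -EFinD lte_fin => yS /=.
  rewrite (between_jumps hJ n); last by rewrite yS lerDl -lee_fin y0.
  by rewrite /reward_at addrA.
rewrite stopped_reward_alive//=; last by rewrite al.
by rewrite /reward_at; congr (U (_ - _ * _)); ring.
Qed.

Lemma measurable_reward_of :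
  measurable_fun setT (fun z : R * S => U (g z.2 - c * z.1)).
Proof.
apply: (measurableT_comp (measurable_utility hUC1)).
apply: measurable_funB; last by apply: measurable_funM.
move=> _ B _; rewrite setTI.
have := @measurable_snd _ _ R S measurableT (g @^-1` B) (hS.2 _).
by rewrite setTI.
Qed.

Lemma measurable_stopped_reward n : measurable_fun setT (M n).
Proof.
have mS k := measurable_jump_time hX k.
have mZ k := measurable_embedded hS hX k.
elim: n => [|n IH].
  rewrite (_ : M 0 = fun w => U (g (Z 0 w) - c * t)).
    apply: (@measurableT_comp _ _ _ _ _ _
      (fun z : R * S => U (g z.2 - c * z.1)) setT
      (fun w => (t, Z 0 w)) measurable_reward_of).
    by apply: measurable_fun_pair => //; exact: measurable_cst.
  apply/funext => w; rewrite stopped_reward_alive// /reward_at.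
  by rewrite (jump_time0 hJ) !addr0.
rewrite (_ : M n.+1 = fun w => if alive n w then
   (if stops w n then U (g (Z n w) - c * (t + fine (cand n w)))
    else U (g (Z n.+1 w) - c * (t + Sn n.+1 w))) else M n w).
  apply: measurable_fun_ifT => //.
    by apply: (measurable_alive mh t0 hJ).
  apply: measurable_fun_ifT.
  - by apply: (measurable_stops_before mh t0 hJ).
  - apply: (@measurableT_comp _ _ _ _ _ _
      (fun z : R * S => U (g z.2 - c * z.1)) setT
      (fun w => (t + fine (cand n w), Z n w)) measurable_reward_of).
    apply: measurable_fun_pair => //; apply: measurable_funD => //.
    apply: (measurableT_comp (fine_measurable measurableT)).
    by apply: (measurable_candidate mh t0 hJ).
  - apply: (@measurableT_comp _ _ _ _ _ _
      (fun z : R * S => U (g z.2 - c * z.1)) setT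
      (fun w => (t + Sn n.+1 w, Z n.+1 w)) measurable_reward_of).
    by apply: measurable_fun_pair => //; exact: measurable_funD.
apply/funext => w; case: ifPn => al; last exact: stopped_reward_const.
case: ifPn => sn.
  rewrite /M /payoff (stopping_min al sn); congr (U (g _ - _)).
  have Sc := candidate_ge h0 t0 hJ n w.
  apply: (between_jumps hJ); move: sn Sc; rewrite /stops_before.
  by case: (cand n w) => // y /=; rewrite !lee_fin lte_fin => -> ->.
by rewrite stopped_reward_alive//= ?al// /reward_at addr0.
Qed.

End StoppedReward.

Arguments stopped_reward {R dO dS Omega S} X Sn U g c h t n w.

(** * The stopped reward loses value at each jump *)
Section Supermartingale.
Context {R : realType} {dO dS : measure_display}.
Context {Omega : measurableType dO} {S : measurableType dS}.
Hypothesis hS : countable_discrete S.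
Context {q : S -> S -> R} {X : R -> Omega -> S} {Sn : nat -> Omega -> R}.
Context {P : S -> probability Omega R}.
Hypothesis hX : markov_chain q X Sn P.
Context {U : R -> R} {g : S -> R} {c : R}.
Hypothesis hUC1 : continuously_differentiable U.
Hypothesis hclosed : forall (t : R) (i j : S), 0 <= t ->
  stopping_set q U g c t i -> j != i -> q i j != 0 -> stopping_set q U g c t j.
Context {t : R}.
Hypothesis t0 : 0 <= t.
Context {i : S}.
Hypothesis hi : stopping_set q U g c t i.
Local Notation Z := (embedded X Sn).

Let hJ : jump_times X Sn. Proof. exact: (chain_jumps hX). Qed.
Let hq : intensity_matrix q. Proof. exact: (chain_intensity hX). Qed.
Let mS n : measurable_fun setT (Sn n).
Proof. exact: (measurable_jump_time hX). Qed.
Let mZ n : measurable_fun setT (Z n).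
Proof. exact: (measurable_embedded hS hX). Qed.
Let mZa n a : measurable (Z n @^-1` [set a]).
Proof. exact: (measurable_embedded_eq hS hX). Qed.

Lemma start_state : P i (Z 0 @^-1` [set i]) = 1%E.
Proof.
have [_ _ _ _ /(_ i)[+ _]] := hX; congr (_ = _); congr (P i _).
by apply/seteqP; split => w; rewrite /embedded /= (jump_time0 hJ).
Qed.

(** By [hclosed] no jump leads out of the stopping set, so states outside of it
    are reached with probability zero. *)
Lemma reachable_states n a : ~ stopping_set q U g c t a ->
  P i (Z n @^-1` [set a]) = 0%E.
Proof.
elim: n a => [|n IH] b hb.
  apply/eqP; rewrite -measure_le0.
  apply: (@le_trans _ _ (P i (~` (Z 0 @^-1` [set i])))).
    apply: le_measure; rewrite ?inE//; first exact: measurableC.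
    by move=> w /= -> e; apply: hb; rewrite e.
  by rewrite probability_setC// start_state subee.
set E := Z n.+1 @^-1` [set b].
transitivity (\int[P i]_(w in E) (cst 1%E w))%E.
  by rewrite integral_cst ?mul1e//; exact: mZa.
rewrite (integral_fibers hS (P i) (Z := Z n))//; last exact: mZa.
rewrite integral0_eq// => a _; rewrite integral_cst ?mul1e/=; last first.
  by apply: measurableI; exact: mZa.
have [ab|ab] := eqVneq a b.
  rewrite (_ : _ `&` _ = set0) ?measure0//.
  apply/seteqP; split => // w [/= e1 e2].
  by apply: (embedded_neq hJ n w); rewrite e1 e2.
have [_ _ _ _ /(_ i)[_ law]] := hX.
have := law n setT a b setT _ ab measurableT.
rewrite (_ : _ `&` _ = E `&` Z n @^-1` [set a]); last first.
  by apply/seteqP; split => w /=; rewrite /E /=; tauto.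
move=> ->; last first.
  exact: (@measurableT _ (g_sigma_algebraType (history_events X Sn n))).
have [ha|ha] := pselect (stopping_set q U g c t a); last first.
  by rewrite setTI IH// mul0e.
have [->|qab] := eqVneq (q a b) 0; first by rewrite mul0r mul0e mule0.
by case: hb; apply: hclosed t0 ha _ qab; rewrite eq_sym.
Qed.

Lemma stopping_set_mono {u a} : t <= u -> stopping_set q U g c t a ->
  stopping_set q U g c u a.
Proof. by move=> tu ha v uv; apply: ha; exact: le_trans uv. Qed.

Context {h : nat -> R * S -> \bar R}.
Hypothesis mh : forall k, measurable_fun [set x : R * S | 0 <= x.1] (h k).
Hypothesis h0 : forall k x, 0 <= x.1 -> (0 <= h k x)%E.
Local Notation tau := (markovian_time X Sn h t).
Local Notation alive := (alive h t X Sn).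
Local Notation M := (stopped_reward X Sn U g c h t).
Local Notation W := (reward_at U g c).
Local Notation After := (reward_after U g c).

Let mM n : measurable_fun setT (M n).
Proof. exact: (measurable_stopped_reward hS hX). Qed.

(** An inequality between functions of two successive values of the stopped
    reward holds in mean as soon as it holds for one jump from a state of the
    stopping set. It is applied to the drift of the reward and to the growth of
    its negative part. *)
Section OneStep.
Variables (f1 f2 : R -> R -> R).
Hypothesis mf1 : measurable_fun setT (fun z : R * R => f1 z.1 z.2).
Hypothesis mf2 : measurable_fun setT (fun z : R * R => f2 z.1 z.2).
Hypothesis f10 : forall x y, 0 <= f1 x y.
Hypothesis f20 : forall x y, 0 <= f2 x y.
Hypothesis f12 : forall x, f1 x x <= f2 x x.
Hypothesis f12_jump : forall a u theta, 0 <= u -> stopping_set q U g c u a ->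
  (0 <= theta)%E ->
  (jump_mean q a (fun s b => (f1 (W u a 0) (After a u theta s b))%:E) <=
   jump_mean q a (fun s b => (f2 (W u a 0) (After a u theta s b))%:E))%E.

Lemma integral_alive_state (f : R -> R -> R) n a :
  measurable_fun setT (fun z : R * R => f z.1 z.2) ->
  (forall x y, 0 <= f x y) ->
  let D := [set w | alive n w] `&` Z n @^-1` [set a] in
  (\int[P i]_(w in D) (f (M n w) (M n.+1 w))%:E =
   \int[P i]_(w in D) jump_mean q a (fun s b =>
     (f (W (t + Sn n w) a 0)
        (After a (t + Sn n w) (h n (t + Sn n w, a)) s b))%:E))%E.
Proof.
move=> mf f0 D.
(* h n is measurable on nonnegative times only; theta is constant below *)
pose theta v := h n (posr (t + v), a).
pose F v s b := (f (W (t + v) a 0) (After a (t + v) (theta v) s b))%:E.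
have thE w : theta (Sn n w) = h n (t + Sn n w, a).
  by rewrite /theta /posr max_l// addr_ge0// (jump_time_ge0 hJ).
transitivity
  (\int[P i]_(w in D) F (Sn n w) (Sn n.+1 w - Sn n w)%R (Z n.+1 w))%E.
  apply: eq_integral => w /[!inE] -[/= al Za]; rewrite /F thE -Za.
  rewrite (stopped_reward_alive hX h0 t0)//.
  by rewrite (stopped_reward_next hX h0 t0).
rewrite (integral_jump hS hX).
- by apply: eq_integral => w _; rewrite /F thE.
- exact: (history_alive hX mh t0).
- move=> b; apply/measurable_EFinP.
  have mtheta : measurable_fun setT theta.
    apply: (@measurable_comp _ _ _ _ _ _ [set x : R * S | 0 <= x.1] (h n) setT
      (fun v => (posr (t + v), a))).
    + exact: measurable_nonneg_time.
    + by move=> _ [v _ <-] /=; exact: posr_ge0.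
    + exact: mh.
    + apply: measurable_fun_pair; last exact: measurable_cst.
      by apply: (measurableT_comp measurable_posr); exact: measurable_funD.
  have mU := measurable_utility hUC1.
  have mW a' (k : R * R -> R) : measurable_fun setT k ->
      measurable_fun setT (fun z => U (g a' - c * k z)).
    move=> mk; apply: (measurableT_comp mU).
    by apply: measurable_funB => //; exact: measurable_funM.
  have mv : measurable_fun setT (fun z : R * R => t + z.1).
    by apply: measurable_funD => //; exact: measurable_fst.
  have mvs : measurable_fun setT (fun z : R * R => t + z.1 + z.2).
    by apply: measurable_funD => //; exact: measurable_snd.
  have mth : measurable_fun setT (fun z : R * R => theta z.1).
    by apply: (measurableT_comp mtheta); exact: measurable_fst.
  apply: (@measurableT_comp _ _ _ _ _ _ (fun z : R * R => f z.1 z.2) setT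
    (fun z => (W (t + z.1) a 0, After a (t + z.1) (theta z.1) z.2 b))) => //.
  apply: measurable_fun_pair.
    by apply: mW; exact: measurable_funD.
  apply: measurable_fun_ifT.
  + apply: measurable_fun_lte => //.
    by apply/measurable_EFinP; exact: measurable_snd.
  + apply: mW; apply: measurable_funD => //.
    exact: (measurableT_comp (fine_measurable measurableT)).
  + exact: mW.
- by move=> v s b; rewrite lee_fin.
Qed.

(** The sample space is cut into the event that the rule has stopped, where the
    reward does not change any more, and the events that it is alive in state
    a, which are either covered by [f12_jump] or null. *)
Lemma reward_step n :
  (\int[P i]_w (f1 (M n w) (M n.+1 w))%:E <=
   \int[P i]_w (f2 (M n w) (M n.+1 w))%:E)%E.
Proof.
pose al := [set w | alive n w].
have mal : measurable al := history_measurable hS hX (history_alive hX mh t0).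
have mD a : measurable (al `&` Z n @^-1` [set a]) by exact: measurableI.
have mf (f : R -> R -> R) D :
    measurable_fun setT (fun z : R * R => f z.1 z.2) ->
    measurable_fun D (fun w => (f (M n w) (M n.+1 w))%:E).
  move=> mf; apply: measurable_funTS; apply/measurable_EFinP.
  by apply: (measurableT_comp mf (measurable_fun_pair (mM n) (mM n.+1))).
have split (f : R -> R -> R) :
    measurable_fun setT (fun z : R * R => f z.1 z.2) ->
    (forall x y, 0 <= f x y) ->
    (\int[P i]_w (f (M n w) (M n.+1 w))%:E =
     \int[P i]_(w in ~` al) (f (M n w) (M n.+1 w))%:E +
     \int[@counting S R]_a \int[P i]_(w in al `&` Z n @^-1` [set a])
       (f (M n w) (M n.+1 w))%:E)%E.
  move=> mff f0; rewrite -(integral_fibers hS (P i) (Z := Z n))//; last 2 first.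
  - exact: mf.
  - by move=> w; rewrite lee_fin.
  rewrite -(setvU al) ge0_integral_setU//; last 4 first.
  - exact: measurableC.
  - exact: mf.
  - by move=> w _; rewrite lee_fin.
  - exact/disj_setPCr.
rewrite !split//; apply: leeD.
  apply: le_integral_pointwise => w /negP al_w.
  by rewrite (stopped_reward_const hX h0 t0)// lee_fin.
apply: le_integral_pointwise => a _.
have [ha|ha] := pselect (stopping_set q U g c t a); last first.
  have D0 : P i (al `&` Z n @^-1` [set a]) = 0%E.
    apply/eqP; rewrite -measure_le0 -(reachable_states n a ha).
    by apply: le_measure; rewrite ?inE//.
  by rewrite !null_set_integral//; exact: mf.
rewrite (integral_alive_state f1 n a mf1 f10).
rewrite (integral_alive_state f2 n a mf2 f20).
apply: le_integral_pointwise => w _.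
have u0 : 0 <= t + Sn n w by rewrite addr_ge0// (jump_time_ge0 hJ).
apply: f12_jump => //; last exact: h0.
by apply: stopping_set_mono ha; rewrite lerDl (jump_time_ge0 hJ).
Qed.

End OneStep.
End Supermartingale.

(** * From one jump to all jumps *)

(** A and B stand for the means of the positive and negative parts of a
    supermartingale. If B n is infinite then A n - B n is -oo. Otherwise B is
    finite up to n by monotonicity, the drift inequality makes A finite there,
    and the differences can be compared step by step. *)
Lemma drift_le {R : realType} (A B : nat -> \bar R) :
  (forall n, 0 <= A n)%E -> (forall n, 0 <= B n)%E -> (A 0%N < +oo)%E ->
  (forall n, A n.+1 + B n <= A n + B n.+1)%E ->
  (forall n, B n <= B n.+1)%E ->
  forall n, (A n - B n <= A 0%N - B 0%N)%E.
Proof.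
move=> A0 B0 A0fin drift mono n.
have [->|Bn] := eqVneq (B n) +oo%E; first by rewrite addeNy leNye.
have Bfin k : (k <= n)%N -> B k \is a fin_num.
  move=> kn; rewrite ge0_fin_numE//.
  apply: (@le_lt_trans _ _ (B n)); last by rewrite ltey.
  have homo : {homo B : k l / (k <= l)%N >-> (k <= l)%E}.
    exact: homo_leq (@le_refl _ _) (@le_trans _ _) mono.
  exact: homo.
suff key k : (k <= n)%N -> A k \is a fin_num /\ (A k - B k <= A 0%N - B 0%N)%E.
  by have [] := key n (leqnn n).
elim: k => [|k IH] kn; first by rewrite ge0_fin_numE.
have [Ak le_k] := IH (ltnW kn); have := drift k.
move: (Bfin _ kn) (Bfin _ (ltnW kn)) Ak => fB' fB fA.
have fA' : A k.+1 \is a fin_num.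
  rewrite ge0_fin_numE//; apply: (@le_lt_trans _ _ (A k.+1 + B k)%E).
    by rewrite leeDl.
  apply: le_lt_trans (drift k) _.
  by rewrite -ge0_fin_numE ?adde_ge0// fin_numD fA.
move=> dr; split => //; apply: le_trans le_k.
by rewrite leeBlDr// addeAC leeBrDr.
Qed.

Lemma limn_einf_le {R : realType} (u : (\bar R)^nat) (x : \bar R) :
  (forall n, u n <= x)%E -> (limn_einf u <= x)%E.
Proof.
move=> ux; rewrite limn_einf_lim; apply: lime_le; first exact: is_cvg_einfs.
apply: nearW => n; apply: le_trans (ux n).
by apply: ereal_inf_lbound; exists n => /=.
Qed.

Section Optimality.
Context {R : realType} {dO dS : measure_display}.
Context {Omega : measurableType dO} {S : measurableType dS}.
Hypothesis hS : countable_discrete S.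
Context {q : S -> S -> R} {X : R -> Omega -> S} {Sn : nat -> Omega -> R}.
Context {P : S -> probability Omega R}.
Hypothesis hX : markov_chain q X Sn P.
Context {U : R -> R} {g : S -> R} {c : R}.
Hypothesis hc : 0 < c.
Hypothesis hUincr : forall x y : R, x < y -> U x < U y.
Hypothesis hUC1 : continuously_differentiable U.
Hypothesis hclosed : forall (t : R) (i j : S), 0 <= t ->
  stopping_set q U g c t i -> j != i -> q i j != 0 -> stopping_set q U g c t j.
Local Notation Z := (embedded X Sn).

Let hq : intensity_matrix q := chain_intensity hX.

Lemma integral_start (i : S) (f : Omega -> \bar R) (k : \bar R) :
  measurable_fun setT f -> (forall w, 0 <= f w)%E ->
  (forall w, Z 0 w = i -> f w = k) -> (\int[P i]_w f w = k)%E.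
Proof.
move=> mf f0 fk.
have mE := measurable_embedded_eq hS hX 0 i.
have PE : P i (Z 0 @^-1` [set i]) = 1%E := start_state hX.
rewrite -(setvU (Z 0 @^-1` [set i])) ge0_integral_setU ?setvU//; last 2 first.
- exact: measurableC.
- exact/disj_setPCr.
have PEC : P i (~` (Z 0 @^-1` [set i])) = 0%E.
  by rewrite probability_setC// PE subee.
rewrite [X in (X + _)%E]null_set_integral ?add0e//; last 2 first.
- exact: measurableC.
- exact: measurable_funTS.
transitivity (\int[P i]_(w in Z 0 @^-1` [set i]) k)%E.
  by apply: eq_integral => w /[!inE]; exact: fk.
by rewrite integral_cst// [X in (_ * X)%E]PE mule1.
Qed.

Lemma expectation_start (i : S) (f : Omega -> R) (k : R) :
  measurable_fun setT f -> (forall w, Z 0 w = i -> f w = k) ->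
  ('E_(P i)[f] = k%:E)%E.
Proof.
move=> mf fk; rewrite unlock integral_posr_negr.
rewrite (integral_start i (fun w => (posr (f w))%:E) (posr k)%:E).
- rewrite (integral_start i (fun w => (negr (f w))%:E) (negr k)%:E).
  + by rewrite -EFinB -posr_negr.
  + by apply/measurable_EFinP; exact: (measurableT_comp measurable_negr).
  + by move=> w; rewrite lee_fin negr_ge0.
  + by move=> w /fk ->.
- by apply/measurable_EFinP; exact: (measurableT_comp measurable_posr).
- by move=> w; rewrite lee_fin posr_ge0.
- by move=> w /fk ->.
Qed.

Section StoppedExpectation.
Context {t : R} {i : S} {h : nat -> R * S -> \bar R}.
Hypothesis t0 : 0 <= t.
Hypothesis hi : stopping_set q U g c t i.
Hypothesis mh : forall k, measurable_fun [set x : R * S | 0 <= x.1] (h k).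
Hypothesis h0 : forall k x, 0 <= x.1 -> (0 <= h k x)%E.
Local Notation M := (stopped_reward X Sn U g c h t).

Let mM n : measurable_fun setT (M n).
Proof. exact: (measurable_stopped_reward hS hX). Qed.

Let mnuM (nu : R -> R) n : measurable_fun setT nu ->
  measurable_fun setT (fun w => (nu (M n w))%:E).
Proof.
by move=> mnu; apply/measurable_EFinP; exact: (measurableT_comp mnu).
Qed.

Let mafter (nu : R -> R) a u theta b : measurable_fun setT nu ->
  measurable_fun setT (fun s => (nu (reward_after U g c a u theta s b))%:E).
Proof. by move=> mnu; exact: (measurable_reward_after). Qed.

Let m1 (nu : R -> R) : measurable_fun setT nu ->
  measurable_fun setT (fun z : R * R => nu z.1).
Proof. by move=> mnu; apply: (measurableT_comp mnu); exact: measurable_fst. Qed.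

Let m2 (nu : R -> R) : measurable_fun setT nu ->
  measurable_fun setT (fun z : R * R => nu z.2).
Proof. by move=> mnu; apply: (measurableT_comp mnu); exact: measurable_snd. Qed.

Lemma stopped_reward_drift n :
  (\int[P i]_w (posr (M n.+1 w))%:E + \int[P i]_w (negr (M n w))%:E <=
   \int[P i]_w (posr (M n w))%:E + \int[P i]_w (negr (M n.+1 w))%:E)%E.
Proof.
have mpos k := mnuM posr k measurable_posr.
have mneg k := mnuM negr k measurable_negr.
have pos0 k w : (0 <= (posr (M k w))%:E)%E by rewrite lee_fin posr_ge0.
have neg0 k w : (0 <= (negr (M k w))%:E)%E by rewrite lee_fin negr_ge0.
rewrite -(ge0_integralD (P i) measurableT (fun w _ => pos0 n.+1 w) (mpos n.+1)
  (fun w _ => neg0 n w) (mneg n)).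
rewrite -(ge0_integralD (P i) measurableT (fun w _ => pos0 n w) (mpos n)
  (fun w _ => neg0 n.+1 w) (mneg n.+1)).
apply: (reward_step hS hX hUC1 hclosed t0 hi mh h0
  (fun x y => posr y + negr x) (fun x y => posr x + negr y)).
- exact: measurable_funD (m2 _ measurable_posr) (m1 _ measurable_negr).
- exact: measurable_funD (m1 _ measurable_posr) (m2 _ measurable_negr).
- by move=> x y; rewrite addr_ge0 ?posr_ge0 ?negr_ge0.
- by move=> x y; rewrite addr_ge0 ?posr_ge0 ?negr_ge0.
- by move=> x; exact: lexx.
move=> a u theta u0 ha th0.
have := jump_mean_reward_le hS hq hc hUincr hUC1 ha th0.
set W0 := reward_at U g c u a 0.
have -> : jump_mean q a (fun s b =>
    (posr (reward_after U g c a u theta s b) + negr W0)%:E) =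
    (jump_mean q a (fun s b => (posr (reward_after U g c a u theta s b))%:E) +
    (negr W0)%:E)%E.
  rewrite -[X in (_ = _ + X)%E](jump_mean_cst hS hq a (negr W0)%:E);
    last by rewrite lee_fin negr_ge0.
  rewrite -(jump_meanD hS hq)//.
  + by move=> b; apply: mafter; exact: measurable_posr.
  + by move=> s b; rewrite lee_fin posr_ge0.
  + by move=> s b; rewrite lee_fin negr_ge0.
have -> : jump_mean q a (fun s b =>
    (posr W0 + negr (reward_after U g c a u theta s b))%:E) =
    ((posr W0)%:E +
     jump_mean q a (fun s b => (negr (reward_after U g c a u theta s b))%:E))%E.
  rewrite -[X in (_ = X + _)%E](jump_mean_cst hS hq a (posr W0)%:E);
    last by rewrite lee_fin posr_ge0.
  rewrite -(jump_meanD hS hq)//.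
  + by move=> s b; rewrite lee_fin posr_ge0.
  + by move=> b; apply: mafter; exact: measurable_negr.
  + by move=> s b; rewrite lee_fin negr_ge0.
exact.
Qed.

(** The supermartingale inequality restricted to the event that the reward is
    negative: where it is not, there is nothing to show. *)
Lemma stopped_loss_mono n :
  (\int[P i]_w (negr (M n w))%:E <= \int[P i]_w (negr (M n.+1 w))%:E)%E.
Proof.
apply: (reward_step hS hX hUC1 hclosed t0 hi mh h0
  (fun x y => negr x) (fun x y => negr y)).
- exact: m1 measurable_negr.
- exact: m2 measurable_negr.
- by move=> x y; exact: negr_ge0.
- by move=> x y; exact: negr_ge0.
- by move=> x; exact: lexx.
move=> a u theta u0 ha th0.
have := jump_mean_reward_le hS hq hc hUincr hUC1 ha th0.
set W0 := reward_at U g c u a 0.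
rewrite (jump_mean_cst hS hq) ?lee_fin ?negr_ge0//.
have [[_ ->]|[-> _]] := posr_or_negr W0.
  by move=> _; apply: (jump_mean_ge0 hq) => s b; rewrite lee_fin negr_ge0.
rewrite add0e; apply: le_trans; rewrite leeDr//.
by apply: (jump_mean_ge0 hq) => s b; rewrite lee_fin posr_ge0.
Qed.

End StoppedExpectation.
End Optimality.

(** * The value on the stopping set *)
Section Value.
Context {R : realType} {dO dS : measure_display}.
Context {Omega : measurableType dO} {S : measurableType dS}.
Hypothesis hS : countable_discrete S.
Context {q : S -> S -> R} {X : R -> Omega -> S} {Sn : nat -> Omega -> R}.
Context {P : S -> probability Omega R}.
Hypothesis hX : markov_chain q X Sn P.
Context {U : R -> R} {g : S -> R} {c : R}.
Hypothesis hc : 0 < c.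
Hypothesis hUincr : forall x y : R, x < y -> U x < U y.
Hypothesis hUC1 : continuously_differentiable U.
Hypothesis hA2 : assumption_A2 X Sn P U g c.
Hypothesis hclosed : forall (t : R) (i j : S), 0 <= t ->
  stopping_set q U g c t i -> j != i -> q i j != 0 -> stopping_set q U g c t j.
Context {t : R} {i : S}.
Hypothesis t0 : 0 <= t.
Local Notation Z := (embedded X Sn).
Local Notation V := (value X Sn P U g c).

Let hJ : jump_times X Sn := chain_jumps hX.

Lemma expectation_stopped_le (h : nat -> R * S -> \bar R) n :
  stopping_set q U g c t i ->
  (forall k, measurable_fun [set x : R * S | 0 <= x.1] (h k)) ->
  (forall k x, 0 <= x.1 -> (0 <= h k x)%E) ->
  ('E_(P i)[stopped_reward X Sn U g c h t n] <= (U (g i - c * t))%:E)%E.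
Proof.
move=> hi mh h0; pose M := stopped_reward X Sn U g c h t.
have mM k : measurable_fun setT (M k).
  exact: (measurable_stopped_reward hS hX).
have M0 w : Z 0 w = i -> M 0 w = U (g i - c * t).
  move=> Zi; rewrite /M (stopped_reward_alive hX h0 t0)//.
  by rewrite Zi /reward_at (jump_time0 hJ) !addr0.
have nuM (nu : R -> R) (mnu : measurable_fun setT nu)
    (nu0 : forall x, 0 <= nu x) :
    (\int[P i]_w (nu (M 0 w))%:E = (nu (U (g i - c * t)))%:E)%E.
  apply: (integral_start hS hX i).
  - by apply/measurable_EFinP; exact: (measurableT_comp mnu).
  - by move=> w; rewrite lee_fin.
  - by move=> w /M0 ->.
rewrite unlock integral_posr_negr.
have start : ((U (g i - c * t))%:E =
    \int[P i]_w (posr (M 0 w))%:E - \int[P i]_w (negr (M 0 w))%:E)%E.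
  rewrite (nuM posr measurable_posr posr_ge0).
  by rewrite (nuM negr measurable_negr negr_ge0) -EFinB -posr_negr.
rewrite start; apply: (@drift_le R (fun k => \int[P i]_w (posr (M k w))%:E)%E
  (fun k => \int[P i]_w (negr (M k w))%:E)%E).
- by move=> k; apply: integral_ge0 => w _; rewrite lee_fin posr_ge0.
- by move=> k; apply: integral_ge0 => w _; rewrite lee_fin negr_ge0.
- by rewrite (nuM posr measurable_posr posr_ge0) ltry.
- by move=> k; exact: (stopped_reward_drift hS hX).
- by move=> k; exact: (stopped_loss_mono hS hX).
Qed.

(** Assumption [hA2] bounds the reward of a rule by the limit of its rewards
    stopped at the jump times, each of which is at most that of stopping at
    once. *)
Lemma value_le : stopping_set q U g c t i -> (V t i <= (U (g i - c * t))%:E)%E.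
Proof.
move=> hi; apply: ge_ereal_sup => _ [h [mh h0 hfin] <-].
have htau : stopping_times X P (markovian_time X Sn h t).
  split.
  - by move=> w; exact: (markovian_time_ge0 h0 t0 hJ).
  - by move=> r; exact: (markovian_time_adapted hS hJ mh h0 t0).
  - by move=> j; exact: hfin.
apply: le_trans (hA2 i t _ t0 htau) _; apply: limn_einf_le => n.
exact: expectation_stopped_le.
Qed.

(** The rule that is identically zero stops at time 0. *)
Lemma value_ge : ((U (g i - c * t))%:E <= V t i)%E.
Proof.
pose h0 : nat -> R * S -> \bar R := fun _ _ => 0%E.
have h00 : forall k x, 0 <= x.1 -> (0 <= h0 k x)%E by [].
have tauE s w : 0 <= s -> markovian_time X Sn h0 s w = 0%E.
  move=> s0.
  have stop0 : stops_before X Sn h0 s w 0.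
    rewrite /stops_before /candidate adde0 lte_fin; exact: (jump_time_lt hJ).
  apply/eqP; rewrite eq_le (markovian_time_ge0 h00 s0 hJ) andbT.
  apply: le_trans (markovian_time_le h00 s0 hJ stop0) _.
  by rewrite /candidate adde0 (jump_time0 hJ).
have payE w : payoff X U g c t (markovian_time X Sn h0 t) w =
    U (g (X 0 w) - c * t).
  by rewrite /payoff tauE//= addr0.
rewrite -(expectation_start hS hX i
  (payoff X U g c t (markovian_time X Sn h0 t))).
- apply: ereal_sup_ubound; exists h0 => //; split => //.
  + by move=> k; exact: measurable_cst.
  + move=> j s s0; rewrite (_ : [set _ | _] = setT) ?probability_setT//.
    by apply/seteqP; split => // w _ /=; rewrite tauE// ltry.
- rewrite (funext payE).
  apply: (@measurableT_comp _ _ _ _ _ _ (fun x => U (g x - c * t)) setT (X 0)).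
    by move=> _ B _; exact: hS.2.
  exact: (measurable_chain hX).
- by move=> w; rewrite payE /embedded (jump_time0 hJ) => ->.
Qed.

Lemma value_stopping_set : stopping_set q U g c t i ->
  V t i = (U (g i - c * t))%:E.
Proof. by move=> hi; apply/eqP; rewrite eq_le value_le// value_ge. Qed.

End Value.

Theorem theorem6p1 (R : realType) (dO dS : measure_display)
    (Omega : measurableType dO) (S : measurableType dS)
    (hS : countable_discrete S)
    (q : S -> S -> R) (X : R -> Omega -> S) (Sn : nat -> Omega -> R)
    (P : S -> probability Omega R)
    (hX : markov_chain q X Sn P)
    (U : R -> R) (g : S -> R) (c : R)
    (hc : 0 < c)
    (hUincr : forall x y : R, x < y -> U x < U y)
    (hUconc : strictly_concave U)
    (hA1 : assumption_A1 X P g c)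
    (hA2 : assumption_A2 X Sn P U g c)
    (hUC1 : continuously_differentiable U)
    (hclosed : forall (t : R) (i j : S), 0 <= t ->
       stopping_set q U g c t i -> j != i -> q i j != 0 ->
       stopping_set q U g c t j) :
  forall (t : R) (i : S), 0 <= t -> stopping_set q U g c t i ->
    (forall t' : R, t <= t' ->
       let objective :=
         bellman_objective q U g c (value X Sn P U g c) t' i in
       value X Sn P U g c t' i =
         ereal_sup [set objective theta | theta in [set theta | 0 <= theta]] /\
       (forall theta : R, 0 <= theta -> (objective theta <= objective 0%R)%E)) /\
    value X Sn P U g c t i = (U (g i - c * t))%:E.
Proof.
move=> t i t0 hi; have hq := chain_intensity hX.
have V_at u j : t <= u -> stopping_set q U g c t j ->
    value X Sn P U g c u j = (U (g j - c * u))%:E.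
  move=> tu hj; have u0 : 0 <= u by exact: le_trans tu.
  have hju : stopping_set q U g c u j by exact: stopping_set_mono hj.
  exact: (value_stopping_set hS hX hc hUincr hUC1 hA2 hclosed).
split; last exact: V_at.
move=> t' tt' objective.
have hi' : stopping_set q U g c t' i by exact: stopping_set_mono hi.
have obj0 : objective 0 = (U (g i - c * t'))%:E.
  rewrite /objective /bellman_objective set_itv1 integral_set1 adde0.
  by rewrite mulr0 expR0 mulr1 addr0.
(* every state j that contributes to the sum is again in the stopping set, so
   its value is known and [sum_rate_reward_le] bounds the integrand *)
have obj_le theta : 0 <= theta -> (objective theta <= objective 0%R)%E.
  move=> th0; rewrite obj0 /objective /bellman_objective.
  have E := integral_excess_bound hq hUC1
    (g := g) (c := c) (a := i) (u := t') th0.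
  rewrite /reward_at addr0 in E.
  apply: (@le_trans _ _
    ((U (g i - c * (t' + theta)) * expR (- rate q i * theta))%:E +
     (U (g i - c * t') -
      expR (- rate q i * theta) * U (g i - c * (t' + theta)))%:E)%E);
    last first.
    by rewrite -EFinD lee_fin mulrC addrC subrK.
  apply: leeD2l; rewrite -E; apply: le_integral_pointwise => s /=.
  rewrite in_itv/= => /andP[s0 _].
  rewrite (eq_sum_neq i _
    (fun j => (q i j)%:E * (reward_at U g c t' j s)%:E)%E); last first.
    move=> j ji; have [->|qij] := eqVneq (q i j) 0; first by rewrite !mul0e.
    rewrite V_at//; first by apply: le_trans tt' _; rewrite lerDl.
    exact: hclosed t0 hi ji qij.
  rewrite /exponential_density -mulrA mulrCA EFinM.
  apply: lee_wpmul2l; first by rewrite lee_fin expR_ge0.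
  exact: sum_rate_reward_le.
split=> //; rewrite V_at//; apply/eqP; rewrite eq_le -obj0; apply/andP; split.
  by apply: ereal_sup_ubound; exists 0 => //=.
by apply: ge_ereal_sup => _ [theta /= th0 <-]; exact: obj_le.
Qed.
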